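(* Let $q>0$ be a real number. Let $\tau_q$ be the automorphism of $Q(\mathcal{C})$ given by $\tau_q(a/b)=\tau_q(a)/\tau_q(b)$ for $a,b\in\mathcal{C}$, $b\neq 0$, where $\tau_q\{a(t)\}=\{q\,a(qt)\}$ on $\mathcal{C}$. Then the difference field $(Q(\mathcal{C}),\tau_q)$ has the following properties. (1) $\tau_q\alpha=\alpha$ for every $\alpha\in\mathbb{C}$. (2) $\tau_q l=ql$. (3) $\tau_q s=s/q$. (4) The derivation $D=-s^2\frac{d}{ds}$ of $Q(\mathcal{C})$ satisfies $Dl=1$, and with it $(Q(\mathcal{C}),D,\tau_q)$ is a DT field with $D\tau_q=q\,\tau_qD$ on $Q(\mathcal{C})$ (or, equivalently, $lD\tau_q=\tau_q(lD)$, i.e. $l\cdot D(\tau_q x)=\tau_q(l\cdot Dx)$ for all $x\in Q(\mathcal{C})$).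
   Context: $\mathcal{C}$ is the set of complex-valued continuous functions on $[0,\infty)$; $f\in\mathcal{C}$ is written $\{f(t)\}$. It is a commutative ring without identity under pointwise addition and the convolution product $\{f(t)\}\{g(t)\}=\{\int_0^t f(t-u)g(u)\,du\}$. By Titchmarsh's theorem it has no zero divisors, and $Q(\mathcal{C})$ denotes its field of fractions; $a\in\mathcal{C}$ is identified with $ab/b$ for any nonzero $b\in\mathcal{C}$. A complex number $\alpha$ is identified with $\{\alpha\}/\{1\}\in Q(\mathcal{C})$ (where $\{\alpha\}$ is the constant function), which makes $\mathbb{C}$ a subfield of $Q(\mathcal{C})$; in particular the identity is $1=\{1\}/\{1\}$. Put $l=\{1\}\in\mathcal{C}$ (the constant function $1$) and $s=1/l\in Q(\mathcal{C})$. The derivation $\frac{d}{ds}$ of $Q(\mathcal{C})$ is the unique extension, by the quotient rule, of the map $\{a(t)\}\mapsto\{-t\,a(t)\}$ on $\mathcal{C}$ (which is additive and satisfies the Leibniz rule for convolution). The map $\tau_q$ is a bijection of $\mathcal{C}$ respecting addition and convolution, so the formula $\tau_q(a/b)=\tau_q(a)/\tau_q(b)$ gives a well-defined automorphism of $Q(\mathcal{C})$. A difference field is a field with an injective endomorphism (transforming operator). A DT field is a field equipped with both a derivation and a transforming operator. *)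

(* Defs.v *)
From Stdlib Require Import Reals Lra Lia Psatz.
From Stdlib Require Import FunctionalExtensionality ProofIrrelevance Classical.
From Coquelicot Require Import Coquelicot.
From HB Require Import structures.
Local Open Scope R_scope.

Definition cts (f : R -> R) := forall x, continuous f x.

Lemma cts_pt f x : cts f -> continuity_pt f x.
Proof. intros H; apply continuity_pt_filterlim; apply H. Qed.

Lemma pt_cts f : (forall x, continuity_pt f x) -> cts f.
Proof. intros H x; apply continuity_pt_filterlim; apply H. Qed.

Lemma cts_ex f a b : cts f -> ex_RInt f a b.
Proof. intros H; apply (ex_RInt_continuous (V := R_CompleteNormedModule)); intros; apply H. Qed.

Lemma cts_ext f g : (forall x, f x = g x) -> cts f -> cts g.
Proof. intros E H x; apply continuous_ext with f; auto. Qed.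

Lemma cts_mult f g : cts f -> cts g -> cts (fun x => f x * g x).
Proof. intros; intro; apply (continuous_mult f g); auto. Qed.
Lemma cts_plus f g : cts f -> cts g -> cts (fun x => f x + g x).
Proof. intros Hf Hg x; apply (continuous_plus f g); auto. Qed.
Lemma cts_minus f g : cts f -> cts g -> cts (fun x => f x - g x).
Proof. intros Hf Hg x; apply (continuous_minus f g); auto. Qed.
Lemma cts_opp f : cts f -> cts (fun x => - f x).
Proof. intros Hf x; apply (continuous_opp f); auto. Qed.
Lemma cts_const k : cts (fun _ => k).
Proof. intro; apply continuous_const. Qed.
Lemma cts_id : cts (fun x => x).
Proof. intro; apply continuous_id. Qed.
Lemma cts_comp f g : cts f -> cts g -> cts (fun x => f (g x)).
Proof. intros Hf Hg x. apply (continuous_comp g f); auto. Qed.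
Lemma cts_pow f n : cts f -> cts (fun x => f x ^ n).
Proof.
  intros H; induction n; simpl. apply cts_const. apply cts_mult; auto. Qed.


Definition cts2 (K : R -> R -> R) := forall x y, continuity_2d_pt K x y.

Lemma cts2_fst f : cts f -> cts2 (fun x _ => f x).
Proof.
  intros H x y. apply (continuity_1d_2d_pt_comp f (fun u _ => u)).
  apply cts_pt; auto. apply continuity_2d_pt_id1. Qed.
Lemma cts2_snd f : cts f -> cts2 (fun _ y => f y).
Proof.
  intros H x y. apply (continuity_1d_2d_pt_comp f (fun _ u => u)).
  apply cts_pt; auto. apply continuity_2d_pt_id2. Qed.
Lemma cts2_plus f g : cts2 f -> cts2 g -> cts2 (fun x y => f x y + g x y).
Proof. intros Hf Hg x y; apply continuity_2d_pt_plus; auto. Qed.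
Lemma cts2_minus f g : cts2 f -> cts2 g -> cts2 (fun x y => f x y - g x y).
Proof. intros Hf Hg x y; apply continuity_2d_pt_minus; auto. Qed.
Lemma cts2_mult f g : cts2 f -> cts2 g -> cts2 (fun x y => f x y * g x y).
Proof. intros Hf Hg x y; apply continuity_2d_pt_mult; auto. Qed.
Lemma cts2_comp1 f g : cts f -> cts2 g -> cts2 (fun x y => f (g x y)).
Proof. intros Hf Hg x y. apply continuity_1d_2d_pt_comp; auto. now apply cts_pt. Qed.
Lemma cts2_comp K f g : cts2 K -> cts2 f -> cts2 g -> cts2 (fun x y => K (f x y) (g x y)).
Proof.
  intros HK Hf Hg x y e. destruct (HK (f x y) (g x y) e) as [d Hd].
  destruct (Hf x y d) as [d1 H1]. destruct (Hg x y d) as [d2 H2].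
  assert (Hm : 0 < Rmin d1 d2) by (apply Rmin_case; [apply d1 | apply d2]).
  exists (mkposreal _ Hm); simpl; intros u v Hu Hv.
  apply Hd.
  apply H1; eapply Rlt_le_trans; try eassumption; apply Rmin_l.
  apply H2; eapply Rlt_le_trans; try eassumption; apply Rmin_r.
Qed.
Lemma cts2_diag K : cts2 K -> cts (fun x => K x x).
Proof.
  intros HK. apply pt_cts; intros x. apply continuity_pt_filterlim.
  apply filterlim_locally; intros e. destruct (HK x x e) as [d Hd].
  exists d. intros y Hy. apply Hd; exact Hy.
Qed.
Lemma cts2_r K x : cts2 K -> cts (fun y => K x y).
Proof.
  intros H. apply (cts2_diag (fun _ y => K x y)).
  apply (cts2_comp K (fun _ _ => x) (fun _ y => y)); auto.
  apply (cts2_fst (fun _ => x)), cts_const. apply (cts2_snd (fun y => y)), cts_id. Qed.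
Lemma cts2_l K y : cts2 K -> cts (fun x => K x y).
Proof.
  intros H. apply (cts2_diag (fun x _ => K x y)).
  apply (cts2_comp K (fun x _ => x) (fun _ _ => y)); auto.
  apply (cts2_fst (fun x => x)), cts_id. apply (cts2_snd (fun _ => y)), cts_const. Qed.

Ltac cts2t := repeat first
  [ assumption
  | apply (cts2_fst (fun _ => _)), cts_const
  | apply (cts2_fst (fun x => x)), cts_id
  | apply (cts2_snd (fun x => x)), cts_id
  | apply cts2_minus | apply cts2_plus | apply cts2_mult ].

Lemma cts_param K a b : a <= b -> cts2 K -> cts (fun x => RInt (K x) a b).
Proof.
  intros ab HK x. apply filterlim_locally; intros e.
  assert (He : 0 < e / 2 / (b - a + 1)).
  { apply Rdiv_lt_0_compat. assert (0 < e) by apply e; lra. lra. }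
  destruct (uniform_continuity_2d_1d' K a b x (fun y _ => HK x y) (mkposreal _ He)) as [d Hd].
  exists d. intros y Hy. change (Rabs (y - x) < d) in Hy.
  change (Rabs (RInt (K y) a b - RInt (K x) a b) < e).
  assert (E : RInt (K y) a b - RInt (K x) a b = RInt (fun s => K y s - K x s) a b).
  { symmetry; apply (RInt_minus (V := R_CompleteNormedModule) (K y) (K x));
    apply cts_ex, cts2_r; auto. }
  rewrite E.
  assert (B : norm (RInt (fun s => K y s - K x s) a b) <= (b - a) * (e / 2 / (b - a + 1))).
  { apply (norm_RInt_le_const (V := R_NormedModule) (fun s => K y s - K x s)); auto.
    - intros s Hs. left. apply (Hd s x s y); auto.
      + pose proof (cond_pos d); lra.
      + apply Rabs_lt_between' in Hy. lra.
      + rewrite Rminus_diag, Rabs_R0; apply d.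
    - apply (RInt_correct (V := R_CompleteNormedModule)), cts_ex, cts_minus; apply cts2_r; auto. }
  change (norm (RInt (fun s : R => K y s - K x s) a b)) with (Rabs (RInt (fun s : R => K y s - K x s) a b)) in B.
  eapply Rle_lt_trans; [apply B|].
  assert (0 < e) by apply e. set (t := e / 2 / (b - a + 1)) in *.
  assert (t * (b - a + 1) = e / 2) by (unfold t; field; lra). nra.
Qed.

Lemma RInt_scale g a b : cts g ->
  RInt g a b = RInt (fun s => (b - a) * g ((b - a) * s + a)) 0 1.
Proof.
  intros Hg. symmetry.
  etransitivity. apply (RInt_comp_lin (V := R_CompleteNormedModule) g (b - a) a 0 1).
  apply cts_ex; auto. f_equal; ring.
Qed.

Lemma cts_param_gen K (a b : R -> R) : cts2 K -> cts a -> cts b ->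
  cts (fun x => RInt (K x) (a x) (b x)).
Proof.
  intros HK Ha Hb.
  apply cts_ext with
   (fun x => RInt (fun s => (b x - a x) * K x ((b x - a x) * s + a x)) 0 1).
  { intros x; symmetry; apply RInt_scale. now apply cts2_r. }
  apply (cts_param (fun x s => (b x - a x) * K x ((b x - a x) * s + a x))). lra.
  pose proof (cts2_fst _ Ha). pose proof (cts2_fst _ Hb).
  cts2t. apply (cts2_comp K (fun x _ => x) (fun x s => (b x - a x) * s + a x)); auto; cts2t.
Qed.

Lemma RInt_zero f : RInt (V := R_CompleteNormedModule) f 0 0 = 0.
Proof. apply (RInt_point (V := R_CompleteNormedModule)). Qed.

Lemma is_derive_RInt_cts f a x : cts f -> is_derive (fun t => RInt f a t) x (f x).
Proof.
  intros H. apply (is_derive_RInt (V := R_NormedModule) f _ a).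
  exists (mkposreal 1 Rlt_0_1); intros y _.
  apply (RInt_correct (V := R_CompleteNormedModule)), cts_ex; auto. apply H. Qed.

Lemma eq_derive_zero (f g df : R -> R) : f 0 = g 0 ->
  (forall x, is_derive f x (df x)) -> (forall x, is_derive g x (df x)) ->
  forall x, 0 <= x -> f x = g x.
Proof.
  intros E Hf Hg x [Hx | <-]; auto.
  assert (H : f 0 - g 0 = f x - g x).
  { apply (eq_is_derive (V := R_NormedModule) (fun t => f t - g t) 0 x); auto.
    intros t _. assert (Z : (zero : R) = minus (df t) (df t)) by (symmetry; apply (Rminus_diag (df t))).
    change (is_derive (fun t => f t - g t) t (zero : R)). rewrite Z. apply (is_derive_minus (V := R_NormedModule) f g); auto. }
  lra.
Qed.

Lemma fubini_triangle K T : cts2 K -> 0 <= T ->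
  RInt (fun u => RInt (fun v => K u v) 0 u) 0 T =
  RInt (fun v => RInt (fun u => K u v) v T) 0 T.
Proof.
  intros HK.
  assert (HK' : cts2 (fun v u => K u v)).
  { apply (cts2_comp K (fun v u => u) (fun v u => v)); auto; cts2t. }
  revert T.
  apply eq_derive_zero with (df := fun t => RInt (fun v => K t v) 0 t).
  - now rewrite 2!RInt_zero.
  - intros x.
    apply (is_derive_RInt_cts (fun u => RInt (fun v => K u v) 0 u)).
    apply (cts_param_gen K); auto using cts_const, cts_id.
  - intros x.
    assert (D : forall u v y, is_derive (fun z => RInt (fun u => K u v) y z) u (K u v)).
    { intros. apply (is_derive_RInt_cts (fun u => K u v)). now apply cts2_l. }
    assert (C2 : forall y, cts (fun v => RInt (fun u => K u v) v y)).
    { intros y. apply (cts_param_gen (fun v u => K u v)); auto using cts_const, cts_id. }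
    assert (C3 : forall x t, continuity_2d_pt
      (fun u v : R => Derive (fun z : R => RInt (fun u0 : R => K u0 v) v z) u) x t).
    { intros. apply continuity_2d_pt_ext with K.
      intros; symmetry; apply is_derive_unique, D. apply HK. }
    replace (RInt (fun v => K x v) 0 x) with
     (RInt (fun t => Derive (fun u => RInt (fun u => K u t) t u) x) 0 x +
       RInt (fun u => K u x) x x * 1).
    apply (is_derive_RInt_param_bound_comp_aux3 (fun x t => RInt (fun u => K u t) t x) 0
             (fun x => x) x 1).
    + exists (mkposreal 1 Rlt_0_1); intros y _. now apply cts_ex.
    + exists (mkposreal 1 Rlt_0_1), (mkposreal 1 Rlt_0_1); intros y _. now apply cts_ex.
    + apply (is_derive_id (K := R_AbsRing)).
    + exists (mkposreal 1 Rlt_0_1), (mkposreal 1 Rlt_0_1); intros y _ t _.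
      eexists; apply D.
    + intros; apply C3.
    + exists (mkposreal 1 Rlt_0_1); intros; apply C3.
    + apply (cts_pt (fun t => RInt (fun u => K u t) t x)), C2.
    + rewrite (RInt_point (V := R_CompleteNormedModule)). change (zero : R) with 0.
      rewrite Rmult_0_l, Rplus_0_r. apply RInt_ext. intros.
      apply is_derive_unique, D.
Qed.

Definition rc (f g : R -> R) (t : R) : R := RInt (fun u => f (t - u) * g u) 0 t.

Lemma cts2_rc_in f g : cts f -> cts g -> cts2 (fun t u => f (t - u) * g u).
Proof.
  intros. apply cts2_mult. apply (cts2_comp1 f (fun t u => t - u)); auto; cts2t.
  now apply cts2_snd. Qed.

Lemma cts_rc_in f g t : cts f -> cts g -> cts (fun u => f (t - u) * g u).
Proof. intros; apply (cts2_r (fun t u => f (t - u) * g u)), cts2_rc_in; auto. Qed.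

Lemma cts_rc f g : cts f -> cts g -> cts (rc f g).
Proof.
  intros; apply (cts_param_gen (fun t u => f (t - u) * g u) (fun _ => 0) (fun t => t));
   auto using cts_const, cts_id, cts2_rc_in.
Qed.

Lemma rc_ext f g f' g' t : 0 <= t -> (forall x, 0 <= x <= t -> f x = f' x) ->
  (forall x, 0 <= x <= t -> g x = g' x) -> rc f g t = rc f' g' t.
Proof.
  intros Ht Hf Hg; apply RInt_ext; intros x; rewrite Rmin_left, Rmax_right; auto; intros Hx.
  rewrite Hf, Hg; auto; lra. Qed.

Lemma rc_comm f g t : cts f -> cts g -> rc f g t = rc g f t.
Proof.
  intros Hf Hg; unfold rc.
  set (h := fun u => g (t - u) * f u).
  assert (Hh : cts h) by (apply cts_rc_in; auto).
  assert (E := RInt_comp_lin (V := R_CompleteNormedModule) h (-1) t 0 t (cts_ex _ _ _ Hh)).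
  replace (-1 * 0 + t) with t in E by ring. replace (-1 * t + t) with 0 in E by ring.
  assert (E2 := opp_RInt_swap (V := R_CompleteNormedModule) h 0 t (cts_ex _ _ _ Hh)).
  change (- RInt h 0 t = RInt h t 0) in E2.
  rewrite <- E in E2. apply Ropp_eq_compat in E2. rewrite Ropp_involutive in E2.
  rewrite E2.
  rewrite <- (RInt_opp (V := R_CompleteNormedModule)).
  2: { apply cts_ex. 
    apply (cts_mult (fun _ => -1) (fun y => h (-1 * y + t))). apply cts_const.
    apply (cts_comp h); auto. apply cts_plus; auto using cts_const.
    apply cts_mult; auto using cts_const, cts_id. }
  apply RInt_ext; intros u _. unfold h.
  change (f (t - u) * g u = - (-1 * (g (t - (-1 * u + t)) * f (-1 * u + t)))).
  replace (t - (-1 * u + t)) with u by ring.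
  replace (-1 * u + t) with (t - u) by ring. ring.
Qed.

Lemma rc_plus_r f g h t : cts f -> cts g -> cts h ->
  rc f (fun x => g x + h x) t = rc f g t + rc f h t.
Proof.
  intros; unfold rc.
  rewrite <- (RInt_plus (V := R_CompleteNormedModule) (fun u => f (t - u) * g u));
   try (apply cts_ex, cts_rc_in; auto).
  apply RInt_ext; intros. change plus with Rplus; simpl. ring. Qed.

Lemma rc_minus_r f g h t : cts f -> cts g -> cts h ->
  rc f (fun x => g x - h x) t = rc f g t - rc f h t.
Proof.
  intros; unfold rc. symmetry.
  etransitivity. symmetry.
  apply (RInt_minus (V := R_CompleteNormedModule) (fun u => f (t - u) * g u));
   apply cts_ex, cts_rc_in; auto.
  apply RInt_ext; intros. change minus with Rminus; simpl.
  change (f (t-x) * g x - f (t-x) * h x = f (t - x) * (g x - h x)). ring. Qed.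

Lemma rc_plus_l f g h t : cts f -> cts g -> cts h ->
  rc (fun x => f x + g x) h t = rc f h t + rc g h t.
Proof.
  intros. rewrite rc_comm, rc_plus_r, (rc_comm f h), (rc_comm g h); auto using cts_plus. Qed.
Lemma rc_minus_l f g h t : cts f -> cts g -> cts h ->
  rc (fun x => f x - g x) h t = rc f h t - rc g h t.
Proof.
  intros. rewrite rc_comm, rc_minus_r, (rc_comm f h), (rc_comm g h); auto using cts_minus. Qed.

Lemma RInt_mult_l k f a b : cts f -> RInt (fun x => k * f x) a b = k * RInt f a b.
Proof. intros; apply (RInt_scal (V := R_CompleteNormedModule) f a b k). now apply cts_ex. Qed.
Lemma RInt_mult_r k f a b : cts f -> RInt (fun x => f x * k) a b = RInt f a b * k.
Proof.
  intros. rewrite Rmult_comm, <- RInt_mult_l; auto. apply RInt_ext; intros.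
  apply Rmult_comm. Qed.

Lemma rc_assoc f g h t : 0 <= t -> cts f -> cts g -> cts h ->
  rc f (rc g h) t = rc (rc f g) h t.
Proof.
  intros Ht Hf Hg Hh. unfold rc.
  transitivity (RInt (fun u => RInt (fun v => f (t - u) * (g (u - v) * h v)) 0 u) 0 t).
  { apply RInt_ext; intros. symmetry. apply RInt_mult_l. now apply cts_rc_in. }
  rewrite (fubini_triangle (fun u v => f (t - u) * (g (u - v) * h v))); auto.
  2: { apply cts2_mult.
       apply (cts2_fst (fun u => f (t - u))). apply (cts_comp f); auto. 
       apply cts_minus; auto using cts_const, cts_id.
       apply cts2_rc_in; auto. }
  apply RInt_ext; intros v _.
  rewrite <- RInt_mult_r by (now apply cts_rc_in).
  set (k := fun u => f (t - u) * (g (u - v) * h v)).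
  assert (Hk : cts k).
  { apply cts_mult. apply (cts_comp f); auto. apply cts_minus; auto using cts_const, cts_id.
    apply cts_mult; auto using cts_const. apply (cts_comp g); auto.
    apply cts_minus; auto using cts_const, cts_id. }
  assert (E := RInt_comp_lin (V := R_CompleteNormedModule) k 1 v 0 (t - v) (cts_ex _ _ _ Hk)).
  replace (1 * 0 + v) with v in E by ring. replace (1 * (t - v) + v) with t in E by ring.
  rewrite <- E. apply RInt_ext; intros u _. unfold k.
  change (1 * (f (t - (1 * u + v)) * (g (1 * u + v - v) * h v)) = f (t - v - u) * g u * h v).
  replace (t - (1 * u + v)) with (t - v - u) by ring.
  replace (1 * u + v - v) with u by ring. ring.
Qed.

Lemma RInt_plus_cts f g a b : cts f -> cts g ->
  RInt (fun x => f x + g x) a b = RInt f a b + RInt g a b.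
Proof. intros; apply (RInt_plus (V := R_CompleteNormedModule) f g); now apply cts_ex. Qed.
Lemma RInt_minus_cts f g a b : cts f -> cts g ->
  RInt (fun x => f x - g x) a b = RInt f a b - RInt g a b.
Proof. intros; apply (RInt_minus (V := R_CompleteNormedModule) f g); now apply cts_ex. Qed.
Lemma RInt_Chasles_cts f a b c : cts f -> RInt f a b + RInt f b c = RInt f a c.
Proof. intros; apply (RInt_Chasles (V := R_CompleteNormedModule) f); now apply cts_ex. Qed.

Lemma RInt_bound f a b M : a <= b -> cts f ->
  (forall x, a <= x <= b -> Rabs (f x) <= M) -> Rabs (RInt f a b) <= (b - a) * M.
Proof.
  intros ab Hf HM.
  apply (norm_RInt_le_const (V := R_NormedModule) f); auto.
  now apply (RInt_correct (V := R_CompleteNormedModule)), cts_ex.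
Qed.

Lemma pow_step_bound w phi T M n a K : 0 <= a -> 0 <= M -> (1 <= n)%nat -> cts w -> cts phi ->
  (forall m, (1 <= m)%nat -> Rabs (RInt (fun u => w u ^ m * phi u) 0 T) <= M) ->
  forall j, Rabs (RInt (fun u => ((1 - a * w u ^ n) ^ K - 1) * (w u ^ j * phi u)) 0 T)
    <= M * ((1 + a) ^ K - 1).
Proof.
  intros Ha HM Hn Hw Hp Hm. 
  assert (C : forall K j, cts (fun u => ((1 - a * w u ^ n) ^ K - 1) * (w u ^ j * phi u))).
  { intros. apply cts_mult; [|apply cts_mult; auto; now apply cts_pow].
    apply cts_minus; [|apply cts_const]. apply (cts_pow (fun u => 1 - a * w u ^ n)).
    apply cts_minus; [apply cts_const|]. apply cts_mult; [apply cts_const|now apply cts_pow]. }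
  induction K as [|K IH]; intros j.
  - simpl. rewrite (RInt_ext _ (fun _ => 0)). 2: { intros; simpl; ring. }
    rewrite (RInt_const (V := R_CompleteNormedModule)). change (scal (T - 0) 0) with ((T - 0) * 0).
    rewrite Rmult_0_r, Rabs_R0. lra.
  - rewrite (RInt_ext _ (fun u => ((1 - a * w u ^ n) ^ K - 1) * (w u ^ j * phi u)
       - a * (((1 - a * w u ^ n) ^ K - 1) * (w u ^ (n + j) * phi u) + w u ^ (n + j) * phi u))).
    2: { intros; rewrite pow_add; simpl; ring. }
    assert (Cp : cts (fun u => w u ^ (n + j) * phi u)) by (apply cts_mult; auto; now apply cts_pow).
    rewrite RInt_minus_cts, RInt_mult_l, RInt_plus_cts; auto.
    2: { apply cts_plus; auto. }
    2: { apply cts_mult. apply cts_const. apply cts_plus; auto. }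
    pose proof (IH j) as I1. pose proof (IH (n + j)%nat) as I2.
    pose proof (Hm (n + j)%nat ltac:(lia)) as I3.
    remember (RInt (fun u => ((1 - a * w u ^ n) ^ K - 1) * (w u ^ j * phi u)) 0 T) as A1.
    remember (RInt (fun u => ((1 - a * w u ^ n) ^ K - 1) * (w u ^ (n + j) * phi u)) 0 T) as A2.
    remember (RInt (fun u => w u ^ (n + j) * phi u) 0 T) as A3.
    assert (Rabs (A1 - a * (A2 + A3)) <= Rabs A1 + a * (Rabs A2 + Rabs A3)).
    { unfold Rminus. eapply Rle_trans; [apply Rabs_triang|]. rewrite Rabs_Ropp, Rabs_mult.
      rewrite (Rabs_pos_eq a) by auto. pose proof (Rabs_triang A2 A3). nra. }
    assert (a * (Rabs A2 + Rabs A3) <= a * (M * ((1 + a) ^ K - 1) + M)) by (apply Rmult_le_compat_l; lra).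
    simpl. lra.
Qed.

Lemma pow_le_exp x K : -1 <= x -> (1 + x) ^ K <= exp (INR K * x).
Proof.
  intros Hx. induction K as [|K IH].
  - simpl. rewrite Rmult_0_l, exp_0; lra.
  - rewrite S_INR. simpl. replace ((INR K + 1) * x) with (x + INR K * x) by ring.
    rewrite exp_plus. apply Rmult_le_compat; try lra. apply pow_le; lra. apply exp_ineq1_le. Qed.

Lemma bernoulli x K : 0 <= x <= 1 -> 1 - INR K * x <= (1 - x) ^ K.
Proof.
  intros Hx. induction K as [|K IH]. simpl; lra.
  rewrite S_INR. simpl. assert (0 <= INR K) by apply pos_INR.
  assert ((1-x) * (1 - INR K * x) <= (1-x) * (1-x)^K) by (apply Rmult_le_compat_l; lra). nra. Qed.

Lemma lim_le_const (u : nat -> R) (l a : R) : is_lim_seq u l -> (forall n, (1 <= n)%nat -> a <= u n) -> a <= l.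
Proof.
  intros Hu H. apply (is_lim_seq_le_loc (fun _ => a) u (Finite a) (Finite l)); auto using is_lim_seq_const.
  exists 1%nat; auto. Qed.

(* If the moments of phi against the powers of a decreasing w stay bounded,
   then phi vanishes where 1 < w: integrate phi against 1 - (1 - a w^n)^K,
   which for suitable a and K tends to the indicator of [0, x]. *)
Section Moments.
Variables (w phi : R -> R) (T M : R).
Hypotheses (HT : 0 < T) (Hw : cts w) (Hp : cts phi)
 (w0 : forall x, 0 <= x <= T -> 0 <= w x)
 (wd : forall x y, 0 <= x < y -> y <= T -> w y < w x)
 (Hm : forall m, (1 <= m)%nat -> Rabs (RInt (fun u => w u ^ m * phi u) 0 T) <= M).

Lemma moments_bound x A d n : 0 < x < T -> 1 < w x -> 0 < d -> 0 <= x - d -> x + d <= T ->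
 (forall u, 0 <= u <= T -> Rabs (phi u) <= A) -> (1 <= n)%nat ->
 Rabs (RInt phi 0 x) <= M * (exp ((/ w x) ^ n) - 1) + A * (T * (w x / w (x - d)) ^ n + d + d
   + T * (w (x + d) / w x) ^ n).
Proof.
  intros Hx Hc Hd Hd1 Hd2 HA Hn. set (c := w x) in *.
  assert (HM : 0 <= M). { eapply Rle_trans; [apply Rabs_pos|apply (Hm 1); lia]. }
  assert (HA0 : 0 <= A). { eapply Rle_trans; [apply Rabs_pos|apply (HA 0); lra]. }
  assert (Hcp : 0 < / c) by (apply Rinv_0_lt_compat; lra).
  assert (wmax : forall u, 0 <= u <= T -> w u <= w 0).
  { intros u [[Hu|<-] Hu2]; [left; apply wd; lra|lra]. }
  assert (HK : exists K, (w 0 / c) ^ n <= INR K /\ 1 <= INR K).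
  { destruct (nfloor_ex (Rmax 1 ((w 0 / c) ^ n))) as [k Hk].
    eapply Rle_trans; [|apply Rmax_l]; lra.
    exists (S k). rewrite S_INR.
    pose proof (Rmax_l 1 ((w 0 / c) ^ n)). pose proof (Rmax_r 1 ((w 0 / c) ^ n)). lra. }
  destruct HK as [K [HK1 HK2]].
  set (z := fun u => (w u / c) ^ n).
  assert (z0 : forall u, 0 <= u <= T -> 0 <= z u).
  { intros; apply pow_le. apply Rmult_le_pos; auto; lra. }
  assert (zK : forall u, 0 <= u <= T -> 0 <= z u / INR K <= 1).
  { intros u Hu. split. apply Rdiv_le_0_compat; auto; lra.
    apply Rmult_le_reg_r with (INR K); [lra|]. unfold Rdiv.
    rewrite Rmult_assoc, Rinv_l, Rmult_1_r, Rmult_1_l; [|lra].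
    eapply Rle_trans; [|apply HK1]. apply pow_incr. split.
    apply Rmult_le_pos; auto; lra. apply Rmult_le_compat_r; auto; lra. }
  set (a := (/ c) ^ n / INR K).
  assert (Ha : 0 <= a). { apply Rdiv_le_0_compat. apply pow_le; lra. lra. }
  set (t := fun u => (1 - a * w u ^ n) ^ K - 1).
  assert (tE : forall u, t u = (1 - z u / INR K) ^ K - 1).
  { intros u; unfold t, a, z. do 3 f_equal. unfold Rdiv. rewrite Rpow_mult_distr. ring. }
  assert (Ct : cts t).
  { apply cts_minus; [|apply cts_const]. apply (cts_pow (fun u => 1 - a * w u ^ n)).
    apply cts_minus; [apply cts_const|]. apply cts_mult; [apply cts_const|now apply cts_pow]. }
  assert (t_hi : forall u, 0 <= u <= T -> -1 <= t u <= 0).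
  { intros u Hu. rewrite tE. pose proof (zK u Hu) as Z.
    assert (0 <= (1 - z u / INR K) ^ K) by (apply pow_le; lra).
    assert ((1 - z u / INR K) ^ K <= 1 ^ K) by (apply pow_incr; lra). rewrite pow1 in *. lra. }
  assert (t_lo : forall u, 0 <= u <= T -> - z u <= t u).
  { intros u Hu. rewrite tE. pose proof (bernoulli (z u / INR K) K (zK u Hu)) as B.
    replace (INR K * (z u / INR K)) with (z u) in B by (field; lra). lra. }
  assert (t_up : forall u, 0 <= u <= T -> 0 < z u -> 1 + t u <= / z u).
  { intros u Hu Hz. rewrite tE. pose proof (zK u Hu) as Z.
    pose proof (pow_le_exp (- (z u / INR K)) K ltac:(lra)) as B.
    replace (INR K * - (z u / INR K)) with (- z u) in B by (field; lra).
    rewrite exp_Ropp in B. pose proof (exp_ineq1_le (z u)).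
    assert (/ exp (z u) <= / z u) by (apply Rinv_le_contravar; lra).
    unfold Rminus in *. lra. }
  assert (I0 : Rabs (RInt (fun u => t u * phi u) 0 T) <= M * (exp ((/ c) ^ n) - 1)).
  { rewrite (RInt_ext _ (fun u => ((1 - a * w u ^ n) ^ K - 1) * (w u ^ 0 * phi u))).
    2: { intros; unfold t; simpl; ring. }
    eapply Rle_trans; [apply (pow_step_bound w phi T M n a K); auto|].
    apply Rmult_le_compat_l; auto.
    assert ((1 + a) ^ K <= exp ((/ c) ^ n)); [|lra].
    eapply Rle_trans; [apply pow_le_exp; lra|].
    unfold a. replace (INR K * ((/ c) ^ n / INR K)) with ((/ c) ^ n) by (field; lra). lra. }
  assert (Ctp : cts (fun u => t u * phi u)) by now apply cts_mult.
  assert (Ctp1 : cts (fun u => (1 + t u) * phi u)).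
  { apply cts_mult; auto. apply cts_plus; auto using cts_const. }
  assert (E : RInt phi 0 x = (RInt (fun u => (1 + t u) * phi u) 0 (x - d)
     + RInt (fun u => (1 + t u) * phi u) (x - d) x)
     + (RInt (fun u => t u * phi u) x (x + d) + RInt (fun u => t u * phi u) (x + d) T)
     - RInt (fun u => t u * phi u) 0 T).
  { rewrite !RInt_Chasles_cts; auto.
    rewrite <- (RInt_Chasles_cts (fun u => t u * phi u) 0 x T); auto.
    rewrite (RInt_ext (fun u => (1 + t u) * phi u) (fun u => phi u + t u * phi u)).
    rewrite RInt_plus_cts; auto.
    apply Rminus_diag_uniq; ring.
    intros; simpl; apply Rminus_diag_uniq; ring. }
  assert (wpos : forall u, 0 <= u <= x -> c <= w u).
  { intros u [Hu [Hu2 | ->]]; [left; apply wd; lra | apply Rle_refl]. }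
  assert (Hwd : c < w (x - d)) by (apply wd; lra).
  assert (B1 : Rabs (RInt (fun u => (1 + t u) * phi u) 0 (x - d)) <= (x - d - 0) * ((c / w (x - d)) ^ n * A)).
  { apply RInt_bound; auto. intros u Hu. rewrite Rabs_mult.
    pose proof (t_hi u ltac:(lra)). rewrite (Rabs_pos_eq (1 + t u)) by lra.
    apply Rmult_le_compat; try lra. apply Rabs_pos. 2: apply HA; lra.
    assert (w (x - d) <= w u).
    { destruct Hu as [Hu [Hu2 | ->]]; [left; apply wd; lra | lra]. }
    assert (0 < z u). { apply pow_lt. apply Rdiv_lt_0_compat; lra. }
    eapply Rle_trans; [apply t_up; auto; lra|]. unfold z. rewrite <- pow_inv.
    apply pow_incr. split. left. apply Rinv_0_lt_compat. apply Rdiv_lt_0_compat; lra.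
    unfold Rdiv. rewrite Rinv_mult, Rinv_inv, Rmult_comm.
    apply Rmult_le_compat_l. lra. apply Rinv_le_contravar; lra. }
  assert (B2 : Rabs (RInt (fun u => (1 + t u) * phi u) (x - d) x) <= (x - (x - d)) * A).
  { apply RInt_bound; auto; [lra|]. intros u Hu. rewrite Rabs_mult.
    pose proof (t_hi u ltac:(lra)). rewrite (Rabs_pos_eq (1 + t u)) by lra.
    pose proof (HA u ltac:(lra)). pose proof (Rabs_pos (phi u)). nra. }
  assert (B3 : Rabs (RInt (fun u => t u * phi u) x (x + d)) <= (x + d - x) * A).
  { apply RInt_bound; auto; [lra|]. intros u Hu. rewrite Rabs_mult.
    pose proof (t_hi u ltac:(lra)). rewrite (Rabs_left1 (t u)) by lra.
    pose proof (HA u ltac:(lra)). pose proof (Rabs_pos (phi u)). nra. }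
  assert (B4 : Rabs (RInt (fun u => t u * phi u) (x + d) T) <= (T - (x + d)) * ((w (x + d) / c) ^ n * A)).
  { apply RInt_bound; auto; try lra. intros u Hu. rewrite Rabs_mult.
    pose proof (t_hi u ltac:(lra)). rewrite (Rabs_left1 (t u)) by lra.
    apply Rmult_le_compat; try lra. apply Rabs_pos. 2: apply HA; lra.
    pose proof (t_lo u ltac:(lra)). eapply Rle_trans; [|].
    instantiate (1 := z u). lra. unfold z.
    apply pow_incr. split. apply Rmult_le_pos; [apply w0; lra|lra].
    apply Rmult_le_compat_r; [lra|].
    destruct Hu as [[Hu | <-] Hu2]; [left; apply wd; lra | lra]. }
  rewrite E. 
  set (J1 := RInt (fun u => (1 + t u) * phi u) 0 (x - d)) in *.
  set (J2 := RInt (fun u => (1 + t u) * phi u) (x - d) x) in *.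
  set (J3 := RInt (fun u => t u * phi u) x (x + d)) in *.
  set (J4 := RInt (fun u => t u * phi u) (x + d) T) in *.
  set (J0 := RInt (fun u => t u * phi u) 0 T) in *.
  set (p := (c / w (x - d)) ^ n) in *. set (r := (w (x + d) / c) ^ n) in *.
  assert (0 <= p) by (apply pow_le, Rdiv_le_0_compat; lra).
  assert (0 <= r).
  { apply pow_le, Rdiv_le_0_compat; [apply w0; lra|lra]. }
  assert ((x - d - 0) * (p * A) <= T * (p * A)) by (apply Rmult_le_compat_r; [apply Rmult_le_pos; lra|lra]).
  assert ((T - (x + d)) * (r * A) <= T * (r * A)) by (apply Rmult_le_compat_r; [apply Rmult_le_pos; lra|lra]).
  assert (Rabs (J1 + J2 + (J3 + J4) - J0) <= Rabs J1 + Rabs J2 + Rabs J3 + Rabs J4 + Rabs J0).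
  { unfold Rminus. eapply Rle_trans; [apply Rabs_triang|]. rewrite Rabs_Ropp.
    pose proof (Rabs_triang (J1 + J2) (J3 + J4)). pose proof (Rabs_triang J1 J2).
    pose proof (Rabs_triang J3 J4). lra. }
  lra.
Qed.

Lemma moments_int x : 0 < x < T -> 1 < w x -> RInt phi 0 x = 0.
Proof.
  intros Hx Hc.
  destruct (ex_RInt_ub (V := R_NormedModule) phi 0 T (cts_ex _ _ _ Hp)) as [A HA].
  rewrite Rmin_left, Rmax_right in HA by lra.
  assert (HA0 : 0 <= A). { eapply Rle_trans; [apply Rabs_pos|apply (HA 0); lra]. }
  assert (S1 : forall d, 0 < d -> 0 <= x - d -> x + d <= T -> Rabs (RInt phi 0 x) <= A * (d + d)).
  { intros d Hd Hd1 Hd2.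
    assert (w x < w (x - d)) by (apply wd; lra).
    assert (w (x + d) < w x) by (apply wd; lra).
    assert (0 <= w (x + d)) by (apply w0; lra).
    assert (g1 : is_lim_seq (fun n => (/ w x) ^ n) 0).
    { apply is_lim_seq_geom. rewrite Rabs_pos_eq. rewrite <- Rinv_1. apply Rinv_lt_contravar; lra.
      left; apply Rinv_0_lt_compat; lra. }
    assert (g2 : is_lim_seq (fun n => (w x / w (x - d)) ^ n) 0).
    { apply is_lim_seq_geom. rewrite Rabs_pos_eq. apply Rlt_div_l; lra.
      apply Rdiv_le_0_compat; lra. }
    assert (g3 : is_lim_seq (fun n => (w (x + d) / w x) ^ n) 0).
    { apply is_lim_seq_geom. rewrite Rabs_pos_eq. apply Rlt_div_l; lra.
      apply Rdiv_le_0_compat; lra. }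
    assert (g4 : is_lim_seq (fun n => exp ((/ w x) ^ n)) 1).
    { rewrite <- exp_0. apply (is_lim_seq_continuous exp); auto.
      apply derivable_continuous_pt, derivable_pt_exp. }
    refine (lim_le_const (fun n => M * (exp ((/ w x) ^ n) - 1) + A * (T * (w x / w (x - d)) ^ n + d + d
       + T * (w (x + d) / w x) ^ n)) (A * (d + d)) _ _ _).
    2: { intros n Hn. apply moments_bound; auto. }
    replace (A * (d + d)) with (M * (1 - 1) + A * (T * 0 + d + d + T * 0)) by ring.
    apply (is_lim_seq_plus' (fun n => M * (exp ((/ w x) ^ n) - 1))).
    apply is_lim_seq_mult'. apply is_lim_seq_const. apply is_lim_seq_minus'; auto using is_lim_seq_const.
    apply is_lim_seq_mult'. apply is_lim_seq_const.
    repeat first [apply is_lim_seq_plus' | apply is_lim_seq_mult' | apply is_lim_seq_const | assumption]. }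
  destruct (Req_dec (RInt phi 0 x) 0) as [|N]; auto. exfalso.
  assert (P := Rabs_pos_lt _ N). set (r := Rabs (RInt phi 0 x)) in *.
  set (d := Rmin (Rmin x (T - x)) (r / (4 * (A + 1)))).
  assert (0 < r / (4 * (A + 1))) by (apply Rdiv_lt_0_compat; lra).
  assert (0 < d) by (unfold d; repeat apply Rmin_glb_lt; lra).
  assert (d <= x). { eapply Rle_trans; [apply Rmin_l|apply Rmin_l]. }
  assert (d <= T - x). { eapply Rle_trans; [apply Rmin_l|apply Rmin_r]. }
  assert (d <= r / (4 * (A + 1))) by apply Rmin_r.
  pose proof (S1 d ltac:(lra) ltac:(lra) ltac:(lra)).
  assert (A * (d + d) <= (A + 1) * (2 * (r / (4 * (A + 1))))).
  { apply Rmult_le_compat; lra. }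
  replace ((A + 1) * (2 * (r / (4 * (A + 1))))) with (r / 2) in * by (field; lra). lra.
Qed.

Lemma moments x : 0 < x < T -> 1 < w x -> phi x = 0.
Proof.
  intros Hx Hc.
  assert (L : locally x (fun y => RInt phi 0 y = 0)).
  { assert (L1 : locally x (fun y => 0 < y < T)).
    { apply (locally_interval (fun y => 0 < y < T) x 0 T); simpl; intros; lra. }
    assert (L2 : locally x (fun y => 1 < w y)).
    { apply (Hw x (fun z => 1 < z)). apply (locally_interval (fun z => 1 < z) (w x) 1 p_infty); simpl; auto. }
    generalize (filter_and _ _ L1 L2). apply filter_imp. intros y [H1 H2]. now apply moments_int. }
  assert (D1 := is_derive_RInt_cts phi 0 x Hp).
  apply is_derive_unique in D1.
  assert (D2 : is_derive (fun t => RInt phi 0 t) x 0).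
  { apply (is_derive_ext_loc (fun _ => 0)). apply filter_imp with (2 := L); intros ? ->; reflexivity.
    apply (is_derive_const (K := R_AbsRing) (V := R_NormedModule)). }
  apply is_derive_unique in D2. congruence.
Qed.
End Moments.

(* A function on [0, oo) is represented by its extension by 0 to the negative
   reals, so that Leibniz equality of representatives is equality on [0, oo).
   [continuous_on D f] is continuity of the restriction of f to D: at 0 only
   the one-sided limit matters. *)
Record cfun : Type := Cfun {
  cfun_val :> R -> C;
  cfun_cont : continuous_on (fun t => 0 <= t) cfun_val;
  cfun_neg : forall t, t < 0 -> cfun_val t = RtoC 0 }.

Definition halfline (F : R -> C) (t : R) : C := if Rle_dec 0 t then F t else RtoC 0.

Lemma halfline_cont F : continuous_on (fun t => 0 <= t) F ->
  continuous_on (fun t => 0 <= t) (halfline F).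
Proof.
  intros HF t Ht. unfold halfline at 2. destruct (Rle_dec 0 t) as [_|]; [|easy].
  apply filterlim_within_ext with F.
  intros u Hu; unfold halfline; destruct (Rle_dec 0 u); easy. now apply HF.
Qed.

Lemma halfline_neg F t : t < 0 -> halfline F t = RtoC 0.
Proof. intros Ht; unfold halfline; destruct (Rle_dec 0 t); [lra|easy]. Qed.

Definition mkcfun (F : R -> C) (HF : continuous_on (fun t => 0 <= t) F) : cfun :=
  Cfun (halfline F) (halfline_cont F HF) (halfline_neg F).

Lemma mkcfunE F HF t : 0 <= t -> mkcfun F HF t = F t.
Proof. intros Ht; simpl; unfold halfline; destruct (Rle_dec 0 t); easy. Qed.

Lemma cfun_ext (f g : cfun) : (forall t, 0 <= t -> f t = g t) -> f = g.
Proof.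
  intros H.
  assert (E : cfun_val f = cfun_val g).
  { apply functional_extensionality; intros t. destruct (Rle_lt_dec 0 t) as [Ht|Ht].
    auto. now rewrite 2!cfun_neg. }
  destruct f as [f cf nf], g as [g cg ng]; simpl in E; subst g.
  f_equal; apply proof_irrelevance.
Qed.

Definition ext_re (f : R -> C) (t : R) : R := Re (f (Rmax 0 t)).
Definition ext_im (f : R -> C) (t : R) : R := Im (f (Rmax 0 t)).

Lemma cont_ext (f : R -> C) : continuous_on (fun t => 0 <= t) f ->
  forall t, continuous (fun t => f (Rmax 0 t)) t.
Proof.
  intros Hf t. unfold continuous.
  apply filterlim_comp with (within (fun t => 0 <= t) (locally (Rmax 0 t))).
  2: { apply Hf, Rmax_l. }
  intros P [e He]. exists e. intros u Hu. apply He; [|apply Rmax_l].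
  change (Rabs (Rmax 0 u - Rmax 0 t) < e). change (Rabs (u - t) < e) in Hu.
  eapply Rle_lt_trans; [|apply Hu].
  unfold Rmax; destruct (Rle_dec 0 u), (Rle_dec 0 t);
    unfold Rabs; repeat destruct Rcase_abs; lra.
Qed.

Lemma cts_ext_re f : continuous_on (fun t => 0 <= t) f -> cts (ext_re f).
Proof.
  intros Hf t. apply (continuous_comp (fun t => f (Rmax 0 t)) fst).
  now apply cont_ext. destruct (f (Rmax 0 t)); apply continuous_fst. Qed.
Lemma cts_ext_im f : continuous_on (fun t => 0 <= t) f -> cts (ext_im f).
Proof.
  intros Hf t. apply (continuous_comp (fun t => f (Rmax 0 t)) snd).
  now apply cont_ext. destruct (f (Rmax 0 t)); apply continuous_snd. Qed.

Lemma cre (f : cfun) : cts (ext_re f). Proof. apply cts_ext_re, cfun_cont. Qed.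
Lemma cim (f : cfun) : cts (ext_im f). Proof. apply cts_ext_im, cfun_cont. Qed.
#[local] Hint Resolve cre cim : core.

Lemma ext_reE f t : 0 <= t -> ext_re f t = Re (f t).
Proof. intros; unfold ext_re; now rewrite Rmax_right. Qed.
Lemma ext_imE f t : 0 <= t -> ext_im f t = Im (f t).
Proof. intros; unfold ext_im; now rewrite Rmax_right. Qed.

Lemma cfun_ext2 (f g : cfun) : (forall t, 0 <= t -> ext_re f t = ext_re g t) ->
  (forall t, 0 <= t -> ext_im f t = ext_im g t) -> f = g.
Proof.
  intros H1 H2; apply cfun_ext; intros t Ht.
  specialize (H1 t Ht); specialize (H2 t Ht).
  rewrite !ext_reE in H1; auto. rewrite !ext_imE in H2; auto.
  unfold Re, Im in *. destruct (f t), (g t); simpl in *; congruence.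
Qed.

Lemma cont_pair (a b : R -> R) : cts a -> cts b ->
  continuous_on (fun t => 0 <= t) (fun t => (a t, b t) : C).
Proof.
  intros Ha Hb. apply continuous_on_forall; intros t _.
  apply filterlim_locally; intros e.
  pose proof (proj1 (filterlim_locally a (a t)) (Ha t) e) as A1.
  pose proof (proj1 (filterlim_locally b (b t)) (Hb t) e) as B1.
  generalize (filter_and _ _ A1 B1). apply filter_imp. intros u [H1 H2]; now split.
Qed.

Lemma cont_on_ext (F G : R -> C) : (forall t, 0 <= t -> F t = G t) ->
  continuous_on (fun t => 0 <= t) F -> continuous_on (fun t => 0 <= t) G.
Proof.
  intros E HF t Ht. rewrite <- E; auto. apply filterlim_within_ext with F; auto. Qed.

Lemma cont_on_pair (F : R -> C) (a b : R -> R) : cts a -> cts b ->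
  (forall t, 0 <= t -> F t = (a t, b t)) -> continuous_on (fun t => 0 <= t) F.
Proof.
  intros Ha Hb E. apply cont_on_ext with (fun t => (a t, b t)).
  intros; now rewrite E. now apply cont_pair. Qed.

Lemma is_CInt (f : R -> C) (fr fi : R -> R) a b : a <= b -> cts fr -> cts fi ->
  (forall t, a <= t <= b -> f t = (fr t, fi t)) ->
  is_RInt (V := C_R_CompleteNormedModule) f a b (RInt fr a b, RInt fi a b).
Proof.
  intros ab Hr Hi E.
  apply (is_RInt_ext (V := C_R_NormedModule) (fun t => (fr t, fi t))).
  rewrite Rmin_left, Rmax_right; auto. intros; symmetry; apply E; lra.
  apply (is_RInt_fct_extend_pair (U := R_NormedModule) (V := R_NormedModule));
   apply (RInt_correct (V := R_CompleteNormedModule)), cts_ex; auto.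
Qed.

Lemma CInt_pair (f : R -> C) (fr fi : R -> R) a b : a <= b -> cts fr -> cts fi ->
  (forall t, a <= t <= b -> f t = (fr t, fi t)) ->
  RInt (V := C_R_CompleteNormedModule) f a b = (RInt fr a b, RInt fi a b).
Proof. intros. apply is_RInt_unique. now apply is_CInt. Qed.

Definition conv_fun (f g : R -> C) (t : R) : C :=
  RInt (V := C_R_CompleteNormedModule) (fun u => Cmult (f (t - u)) (g u)) 0 t.

Definition rcre (f g : cfun) t := rc (ext_re f) (ext_re g) t - rc (ext_im f) (ext_im g) t.
Definition rcim (f g : cfun) t := rc (ext_re f) (ext_im g) t + rc (ext_im f) (ext_re g) t.

Lemma pairE (f : cfun) t : 0 <= t -> f t = (ext_re f t, ext_im f t).
Proof. intros; rewrite ext_reE, ext_imE by auto. unfold Re, Im; now destruct (f t). Qed.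

Lemma conv_in (f g : cfun) t u : 0 <= u <= t -> Cmult (f (t - u)) (g u) =
  (ext_re f (t - u) * ext_re g u - ext_im f (t - u) * ext_im g u,
   ext_re f (t - u) * ext_im g u + ext_im f (t - u) * ext_re g u).
Proof. intros; rewrite 2!pairE by lra. reflexivity. Qed.

Lemma conv_funE (f g : cfun) t : 0 <= t -> conv_fun f g t = (rcre f g t, rcim f g t).
Proof.
  intros Ht. unfold conv_fun, rcre, rcim, rc.
  rewrite <- RInt_minus_cts, <- RInt_plus_cts; try (apply cts_rc_in; auto).
  apply CInt_pair; auto.
  apply cts_minus; apply cts_rc_in; auto.
  apply cts_plus; apply cts_rc_in; auto.
  intros; now apply conv_in.
Qed.

Lemma conv_cont (f g : cfun) : continuous_on (fun t => 0 <= t) (conv_fun f g).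
Proof.
  apply cont_on_pair with (rcre f g) (rcim f g).
  apply cts_minus; apply cts_rc; auto.
  apply cts_plus; apply cts_rc; auto.
  intros; now apply conv_funE.
Qed.

(* Locked: unification would otherwise unfold conv down to Riemann sums. *)
HB.lock Definition conv (f g : cfun) : cfun := mkcfun (conv_fun f g) (conv_cont f g).

Lemma convE (f g : cfun) t : 0 <= t -> conv f g t = conv_fun f g t.
Proof. intros Ht; rewrite conv.unlock; now apply mkcfunE. Qed.

Lemma conv_re f g t : 0 <= t -> ext_re (conv f g) t = rcre f g t.
Proof. intros; rewrite ext_reE; auto. rewrite convE; auto. now rewrite conv_funE. Qed.
Lemma conv_im f g t : 0 <= t -> ext_im (conv f g) t = rcim f g t.
Proof. intros; rewrite ext_imE; auto. rewrite convE; auto. now rewrite conv_funE. Qed.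

Lemma add_cont (f g : cfun) : continuous_on (fun t => 0 <= t) (fun t => Cplus (f t) (g t)).
Proof.
  apply cont_on_pair with (fun t => ext_re f t + ext_re g t) (fun t => ext_im f t + ext_im g t).
  now apply cts_plus. now apply cts_plus. intros t Ht; now rewrite 2!pairE. Qed.
Definition cadd (f g : cfun) : cfun := mkcfun _ (add_cont f g).

Lemma opp_cont (f : cfun) : continuous_on (fun t => 0 <= t) (fun t => Copp (f t)).
Proof.
  apply cont_on_pair with (fun t => - ext_re f t) (fun t => - ext_im f t).
  now apply cts_opp. now apply cts_opp. intros t Ht; now rewrite pairE. Qed.
Definition copp (f : cfun) : cfun := mkcfun _ (opp_cont f).

Lemma const_cont (a : C) : continuous_on (fun t => 0 <= t) (fun _ => a).
Proof. apply continuous_on_forall; intros; apply continuous_const. Qed.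
Definition cconst (a : C) : cfun := mkcfun _ (const_cont a).

Lemma mulw_cont (w : R -> R) (Hw : cts w) (f : cfun) :
  continuous_on (fun t => 0 <= t) (fun t => Cmult (RtoC (w t)) (f t)).
Proof.
  apply cont_on_pair with (fun t => w t * ext_re f t) (fun t => w t * ext_im f t).
  now apply cts_mult. now apply cts_mult. intros t Ht; rewrite pairE; auto.
  unfold Cmult; simpl. f_equal; ring. Qed.
(* {w(t) f(t)} *)
Definition mulw w Hw (f : cfun) : cfun := mkcfun _ (mulw_cont w Hw f).

Lemma cadd_re f g t : 0 <= t -> ext_re (cadd f g) t = ext_re f t + ext_re g t.
Proof. intros; rewrite !ext_reE; auto. unfold cadd. now rewrite mkcfunE. Qed.
Lemma cadd_im f g t : 0 <= t -> ext_im (cadd f g) t = ext_im f t + ext_im g t.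
Proof. intros; rewrite !ext_imE; auto. unfold cadd. now rewrite mkcfunE. Qed.
Lemma mulw_re w H f t : 0 <= t -> ext_re (mulw w H f) t = w t * ext_re f t.
Proof. intros; rewrite !ext_reE; auto. unfold mulw. rewrite mkcfunE; auto. apply re_scal_l. Qed.
Lemma mulw_im w H f t : 0 <= t -> ext_im (mulw w H f) t = w t * ext_im f t.
Proof. intros; rewrite !ext_imE; auto. unfold mulw. rewrite mkcfunE; auto. apply im_scal_l. Qed.
Lemma cconst_re a t : 0 <= t -> ext_re (cconst a) t = Re a.
Proof. intros; rewrite !ext_reE; auto. unfold cconst. now rewrite mkcfunE. Qed.
Lemma cconst_im a t : 0 <= t -> ext_im (cconst a) t = Im a.
Proof. intros; rewrite !ext_imE; auto. unfold cconst. now rewrite mkcfunE. Qed.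

Lemma conv_comm f g : conv f g = conv g f.
Proof.
  apply cfun_ext2; intros t Ht; [rewrite !conv_re|rewrite !conv_im]; auto; unfold rcre, rcim.
  rewrite (rc_comm (ext_re f)), (rc_comm (ext_im f)); auto.
  rewrite (rc_comm (ext_re f)), (rc_comm (ext_im f)); auto. ring.
Qed.

Lemma conv_add_r f g h : conv f (cadd g h) = cadd (conv f g) (conv f h).
Proof.
  assert (P : forall k : R -> R, cts k -> forall t, 0 <= t ->
   rc k (ext_re (cadd g h)) t = rc k (ext_re g) t + rc k (ext_re h) t /\
   rc k (ext_im (cadd g h)) t = rc k (ext_im g) t + rc k (ext_im h) t).
  { intros k Hk t Ht. split; (rewrite <- rc_plus_r; auto; apply rc_ext; auto).
    intros; apply cadd_re; lra. intros; apply cadd_im; lra. }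
  apply cfun_ext2; intros t Ht; [rewrite cadd_re, !conv_re|rewrite cadd_im, !conv_im]; auto; unfold rcre, rcim;
  destruct (P _ (cre f) t Ht) as [E1 E2], (P _ (cim f) t Ht) as [E3 E4];
  rewrite ?E1, ?E2, ?E3, ?E4; ring.
Qed.

Lemma conv_assoc f g h : conv f (conv g h) = conv (conv f g) h.
Proof.
  assert (C1 : forall f g, cts (rcre f g)) by (intros; apply cts_minus; apply cts_rc; auto).
  assert (C2 : forall f g, cts (rcim f g)) by (intros; apply cts_plus; apply cts_rc; auto).
  apply cfun_ext2; intros t Ht.
  - rewrite 2!conv_re; auto; unfold rcre at 1 2.
    rewrite (rc_ext _ (ext_re (conv g h)) (ext_re f) (rcre g h)),
     (rc_ext _ (ext_im (conv g h)) (ext_im f) (rcim g h)),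
     (rc_ext (ext_re (conv f g)) _ (rcre f g) (ext_re h)),
     (rc_ext (ext_im (conv f g)) _ (rcim f g) (ext_im h)); auto; intros;
     try (apply conv_re; lra); try (apply conv_im; lra).
    unfold rcre, rcim. change (fun x => ?a x) with a.
    rewrite (rc_minus_r _ (rc _ _) (rc _ _)), (rc_plus_r _ (rc _ _) (rc _ _)),
      (rc_minus_l (rc _ _) (rc _ _)), (rc_plus_l (rc _ _) (rc _ _)); auto using cts_rc.
    rewrite !rc_assoc; auto. ring.
  - rewrite 2!conv_im; auto; unfold rcim at 1 2.
    rewrite (rc_ext _ (ext_im (conv g h)) (ext_re f) (rcim g h)),
     (rc_ext _ (ext_re (conv g h)) (ext_im f) (rcre g h)),
     (rc_ext (ext_re (conv f g)) _ (rcre f g) (ext_im h)),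
     (rc_ext (ext_im (conv f g)) _ (rcim f g) (ext_re h)); auto; intros;
     try (apply conv_re; lra); try (apply conv_im; lra).
    unfold rcre, rcim.
    rewrite (rc_minus_r _ (rc _ _) (rc _ _)), (rc_plus_r _ (rc _ _) (rc _ _)),
      (rc_minus_l (rc _ _) (rc _ _)), (rc_plus_l (rc _ _) (rc _ _)); auto using cts_rc.
    rewrite !rc_assoc; auto. ring.
Qed.

Definition cf0 := cconst (RtoC 0).
Definition cl := cconst (RtoC 1).

Lemma cf0E t : cf0 t = RtoC 0.
Proof. simpl; unfold halfline; now destruct (Rle_dec 0 t). Qed.

Lemma conv_0_r f : conv f cf0 = cf0.
Proof.
  apply cfun_ext; intros t Ht. rewrite cf0E. rewrite convE; auto.
  unfold conv_fun. rewrite (RInt_ext _ (fun _ => zero)).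
  rewrite (RInt_const (V := C_R_CompleteNormedModule)). apply (scal_zero_r (V := C_R_CompleteNormedModule)).
  intros u _. rewrite cf0E. apply Cmult_0_r.
Qed.
Lemma conv_0_l f : conv cf0 f = cf0.
Proof. rewrite conv_comm; apply conv_0_r. Qed.

Lemma cadd_comm f g : cadd f g = cadd g f.
Proof. apply cfun_ext; intros; unfold cadd; rewrite !mkcfunE; auto. apply Cplus_comm. Qed.
Lemma cadd_assoc f g h : cadd f (cadd g h) = cadd (cadd f g) h.
Proof. apply cfun_ext; intros; unfold cadd; rewrite !mkcfunE; auto. apply Cplus_assoc. Qed.
Lemma cadd_0_l f : cadd cf0 f = f.
Proof. apply cfun_ext; intros; unfold cadd; rewrite !mkcfunE, cf0E; auto. apply Cplus_0_l. Qed.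
Lemma cadd_opp_l f : cadd (copp f) f = cf0.
Proof. apply cfun_ext; intros; unfold cadd, copp; rewrite !mkcfunE, cf0E; auto.
  rewrite Cplus_comm; apply Cplus_opp_r. Qed.

Lemma mulw_leibniz w (Hw : cts w) (Hadd : forall x y, w (x + y) = w x + w y) f g :
  mulw w Hw (conv f g) = cadd (conv (mulw w Hw f) g) (conv f (mulw w Hw g)).
Proof.
  set (T := mulw w Hw).
  assert (P : forall a b, cts a -> cts b -> forall t, w t * rc a b t = rc (fun u => w u * a u) b t + rc a (fun u => w u * b u) t).
  { intros a b Ha Hb t. unfold rc.
    assert (C1 := cts_mult _ _ Hw Ha). assert (C2 := cts_mult _ _ Hw Hb).
    rewrite <- RInt_mult_l, <- RInt_plus_cts; try apply cts_rc_in; auto;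
     try (apply (cts_rc_in (fun u => w u * a u) b t); auto); try (apply (cts_rc_in a (fun u => w u * b u) t); auto).
    apply RInt_ext; intros x _; apply Rminus_diag_uniq.
    replace (w t) with (w (t - x) + w x) by (rewrite <- Hadd; f_equal; ring). ring. }
  assert (Q1 : forall f a t, cts a -> 0 <= t -> rc (ext_re (T f)) a t = rc (fun u => w u * ext_re f u) a t).
  { intros; apply rc_ext; auto. intros; apply mulw_re; lra. }
  assert (Q2 : forall f a t, cts a -> 0 <= t -> rc (ext_im (T f)) a t = rc (fun u => w u * ext_im f u) a t).
  { intros; apply rc_ext; auto. intros; apply mulw_im; lra. }
  assert (Q3 : forall f a t, cts a -> 0 <= t -> rc a (ext_re (T f)) t = rc a (fun u => w u * ext_re f u) t).
  { intros; apply rc_ext; auto. intros; apply mulw_re; lra. }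
  assert (Q4 : forall f a t, cts a -> 0 <= t -> rc a (ext_im (T f)) t = rc a (fun u => w u * ext_im f u) t).
  { intros; apply rc_ext; auto. intros; apply mulw_im; lra. }
  apply cfun_ext2; intros t Ht.
  - rewrite cadd_re; auto. unfold T at 1. rewrite mulw_re, !conv_re; auto. unfold rcre.
    rewrite Q1, Q2, Q3, Q4; auto. rewrite Rmult_minus_distr_l, !P; auto; ring.
  - rewrite cadd_im; auto. unfold T at 1. rewrite mulw_im, !conv_im; auto. unfold rcim.
    rewrite Q1, Q2, Q3, Q4; auto. rewrite Rmult_plus_distr_l, !P; auto; ring.
Qed.

Lemma cts_exp k : cts (fun t => exp (- (k * t))).
Proof.
  apply (cts_comp exp). apply pt_cts; intros; apply derivable_continuous_pt, derivable_pt_exp.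
  apply cts_opp, cts_mult; auto using cts_const, cts_id. Qed.

Lemma mulw_exp_conv k f g : mulw _ (cts_exp k) (conv f g) =
  conv (mulw _ (cts_exp k) f) (mulw _ (cts_exp k) g).
Proof.
  apply cfun_ext; intros t Ht. unfold mulw at 1. rewrite mkcfunE; auto.
  rewrite !convE; auto. unfold conv_fun.
  rewrite <- scal_R_Cmult.
  symmetry; etransitivity; [|apply (RInt_scal (V := C_R_CompleteNormedModule))].
  2: { eexists; apply is_CInt with (fr := fun u => ext_re f (t - u) * ext_re g u - ext_im f (t - u) * ext_im g u)
         (fi := fun u => ext_re f (t - u) * ext_im g u + ext_im f (t - u) * ext_re g u); auto.
       apply cts_minus; apply cts_rc_in; auto.
       apply cts_plus; apply cts_rc_in; auto. intros; now apply conv_in. }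
  apply (RInt_ext (V := C_R_CompleteNormedModule)); intros u; rewrite Rmin_left, Rmax_right; auto; intros Hu.
  match goal with |- _ = scal ?a ?b => etransitivity; [|symmetry; apply (scal_R_Cmult a b)] end.
  unfold mulw; rewrite !mkcfunE; try lra.
  replace (exp (- (k * t))) with (exp (- (k * (t - u))) * exp (- (k * u))).
  rewrite RtoC_mult. match goal with |- @eq _ ?l ?r => change (@eq C l r) end. ring.
  rewrite <- exp_plus; f_equal; ring.
Qed.

Lemma normCE (x : C) : norm (x : C_R_NormedModule) = Cmod x.
Proof. 
  unfold Cmod. change (norm (x : C_R_NormedModule)) with (sqrt (Rabs (fst x) ^ 2 + Rabs (snd x) ^ 2)).
  f_equal. now rewrite 2!pow2_abs. Qed.

Lemma CInt_ex (f : cfun) a b : 0 <= a <= b -> ex_RInt (V := C_R_CompleteNormedModule) f a b.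
Proof. intros H; eexists; apply is_CInt with (fr := ext_re f) (fi := ext_im f); auto; try lra.
  intros; apply pairE; lra. Qed.

Lemma conv_ex (f g : cfun) t : 0 <= t ->
  ex_RInt (V := C_R_CompleteNormedModule) (fun u => Cmult (f (t - u)) (g u)) 0 t.
Proof.
  intros; eexists; apply is_CInt with (fr := fun u => ext_re f (t - u) * ext_re g u - ext_im f (t - u) * ext_im g u)
         (fi := fun u => ext_re f (t - u) * ext_im g u + ext_im f (t - u) * ext_re g u); auto.
  apply cts_minus; apply cts_rc_in; auto.
  apply cts_plus; apply cts_rc_in; auto. intros; now apply conv_in. Qed.

Lemma CInt_bound (f : R -> C) a b M : a <= b -> ex_RInt (V := C_R_CompleteNormedModule) f a b ->
  (forall x, a <= x <= b -> Cmod (f x) <= M) -> Cmod (RInt (V := C_R_CompleteNormedModule) f a b) <= (b - a) * M.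
Proof.
  intros ab Hf HM. rewrite <- normCE.
  apply (norm_RInt_le_const (V := C_R_NormedModule) f); auto.
  intros; rewrite normCE; auto. now apply (RInt_correct (V := C_R_CompleteNormedModule)).
Qed.

Lemma cl_conv f t : 0 <= t -> conv cl f t = RInt (V := C_R_CompleteNormedModule) f 0 t.
Proof.
  intros Ht; rewrite convE; auto. apply (RInt_ext (V := C_R_CompleteNormedModule)). intros u.
  rewrite Rmin_left, Rmax_right; auto; intros Hu. unfold cl, cconst. rewrite mkcfunE; try lra.
  apply Cmult_1_l. Qed.

Lemma const_conv f k t : 0 <= t -> conv f (cconst k) t = Cmult k (conv cl f t).
Proof.
  intros Ht. rewrite (pairE (conv f _)), (pairE (conv cl f)), !conv_re, !conv_im; auto.
  rewrite <- conv_re, <- conv_im, (conv_comm f) , conv_re, conv_im; auto.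
  unfold rcre, rcim.
  assert (E : forall a, cts a -> forall c (b : R -> R), (forall t, 0 <= t -> b t = c) -> rc b a t = c * RInt a 0 t).
  { intros a Ha c b Hb. unfold rc. rewrite <- RInt_mult_l; auto. apply RInt_ext; intros u.
    rewrite Rmin_left, Rmax_right; auto; intros Hu. rewrite Hb; auto; lra. }
  rewrite !(E _ (cre f) (Re k) (ext_re (cconst k))), !(E _ (cim f) (Re k) (ext_re (cconst k))),
   !(E _ (cre f) (Im k) (ext_im (cconst k))), !(E _ (cim f) (Im k) (ext_im (cconst k))),
    !(E _ (cre f) 1 (ext_re cl)), !(E _ (cim f) 1 (ext_re cl)),
   !(E _ (cre f) 0 (ext_im cl)), !(E _ (cim f) 0 (ext_im cl)).
  unfold Re, Im; destruct k; unfold Cmult; simpl; f_equal; ring.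
  all: intros; unfold cl; rewrite ?cconst_re, ?cconst_im; auto.
Qed.

(* Mikusinski's estimate: with h(t) = e^{-nt} f(t) one has h * h = 0, so the
   square of the integral of h on [0, 2T] is an integral over the half
   u + v >= 2T of the square only. *)
Lemma sq_bound (f : cfun) T A n : 0 < T -> conv f f = cf0 ->
  (forall t, 0 <= t <= 2 * T -> Cmod (f t) <= A) ->
  Cmod (RInt (V := C_R_CompleteNormedModule) (mulw _ (cts_exp (INR n)) f) 0 T)
   <= 3 * T * A * exp (- (INR n * T)).
Proof.
  intros HT Hff HA. set (k := INR n). set (h := mulw _ (cts_exp k) f).
  assert (Hk : 0 <= k) by apply pos_INR.
  assert (HA0 : 0 <= A). { eapply Rle_trans; [apply Cmod_ge_0|apply (HA 0); lra]. }
  assert (hb : forall t, 0 <= t <= 2 * T -> Cmod (h t) <= A * exp (- (k * t))).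
  { intros t Ht. unfold h, mulw; rewrite mkcfunE by lra. rewrite Cmod_mult, Cmod_R.
    rewrite Rabs_pos_eq by (left; apply exp_pos). rewrite Rmult_comm.
    apply Rmult_le_compat_r. left; apply exp_pos. auto. }
  assert (Hhh : conv h h = cf0).
  { unfold h. rewrite <- mulw_exp_conv, Hff. apply cfun_ext; intros t Ht.
    unfold mulw; rewrite mkcfunE, cf0E; auto. apply Cmult_0_r. }
  set (H := conv cl h). set (c := H (2 * T)).
  assert (HH : conv h H = cf0).
  { unfold H. rewrite (conv_comm cl), conv_assoc, Hhh. apply conv_0_l. }
  assert (E : conv h (cadd (cconst c) (copp H)) (2 * T) = Cmult c c).
  { assert (EO : conv h (copp H) = cf0).
    { assert (Z : cadd (conv h (copp H)) (conv h H) = cf0).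
      { rewrite <- conv_add_r, cadd_opp_l. apply conv_0_r. }
      rewrite HH, cadd_comm, cadd_0_l in Z. exact Z. }
    rewrite conv_add_r, EO, cadd_comm, cadd_0_l, const_conv by lra. reflexivity. }
  assert (Hd : forall u, 0 <= u <= 2 * T -> Cmod (cadd (cconst c) (copp H) u) <= 2 * T * (A * exp (- (k * u)))).
  { intros u Hu.
    assert (Hs : cadd (cconst c) (copp H) u = RInt (V := C_R_CompleteNormedModule) h u (2 * T)).
    { unfold cadd, cconst, copp; rewrite !mkcfunE by lra. unfold c, H.
      rewrite !cl_conv by lra.
      rewrite <- (RInt_Chasles (V := C_R_CompleteNormedModule) h 0 u (2 * T)); try (apply CInt_ex; lra).
      change plus with Cplus. ring. }
    rewrite Hs. eapply Rle_trans. apply CInt_bound with (M := A * exp (- (k * u))). lra. apply CInt_ex; lra.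
    intros v Hv. eapply Rle_trans; [apply hb; lra|]. apply Rmult_le_compat_l; auto.
    destruct (Req_dec k 0) as [->|]. rewrite !Rmult_0_l; lra.
    destruct Hv as [[Hv | ->] _]; [left; apply exp_increasing; nra|lra].
    apply Rmult_le_compat_r; [apply Rmult_le_pos; auto; left; apply exp_pos|lra]. }
  assert (Hc : Cmod c * Cmod c <= (2 * T * A * exp (- (k * T))) * (2 * T * A * exp (- (k * T)))).
  { rewrite <- Cmod_mult, <- E. rewrite convE by lra.
    unfold conv_fun. eapply Rle_trans. 
    apply CInt_bound with (M := 2 * T * A * A * (exp (- (k * T)) * exp (- (k * T)))). lra. 
    apply conv_ex; lra.
    intros u Hu. rewrite Cmod_mult.
    replace (2 * T * A * A * (exp (- (k * T)) * exp (- (k * T)))) with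
      ((A * exp (- (k * (2 * T - u)))) * (2 * T * (A * exp (- (k * u))))).
    apply Rmult_le_compat; try apply Cmod_ge_0. apply hb; lra. apply Hd; lra.
    transitivity (2 * T * A * A * (exp (- (k * (2 * T - u))) * exp (- (k * u)))). ring.
    rewrite <- !exp_plus. f_equal. f_equal. ring. right; ring. }
  assert (He := exp_pos (- (k * T))).
  assert (Hc' : Cmod c <= 2 * T * A * exp (- (k * T))).
  { apply Rsqr_incr_0_var. exact Hc. repeat apply Rmult_le_pos; lra. }
  assert (Ec : RInt (V := C_R_CompleteNormedModule) h 0 T = Cminus c (RInt (V := C_R_CompleteNormedModule) h T (2 * T))).
  { unfold c, H. rewrite cl_conv by lra.
    rewrite <- (RInt_Chasles (V := C_R_CompleteNormedModule) h 0 T (2 * T)); try (apply CInt_ex; lra).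
    change plus with Cplus. apply Ceq_minus; ring. }
  assert (Ht : Cmod (RInt (V := C_R_CompleteNormedModule) h T (2 * T)) <= (2 * T - T) * (A * exp (- (k * T)))).
  { apply CInt_bound. lra. apply CInt_ex; lra.
    intros v Hv. eapply Rle_trans; [apply hb; lra|]. apply Rmult_le_compat_l; auto.
    destruct (Req_dec k 0) as [->|]. rewrite !Rmult_0_l; lra.
    destruct Hv as [[Hv | ->] _]; [left; apply exp_increasing; nra|lra]. }
  rewrite Ec. unfold Cminus. eapply Rle_trans; [apply Cmod_triangle|]. rewrite Cmod_opp. lra.
Qed.

Lemma exp_powE x n : exp x ^ n = exp (INR n * x).
Proof.
  induction n. simpl. now rewrite Rmult_0_l, exp_0.
  rewrite S_INR. simpl. rewrite IHn, <- exp_plus. f_equal; ring. Qed.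

Lemma cts_zero_at0 a : cts a -> (forall x, 0 < x -> a x = 0) -> a 0 = 0.
Proof.
  intros Ha Hz. destruct (Req_dec (a 0) 0) as [|N]; auto. exfalso.
  assert (He := Rabs_pos_lt _ N).
  destruct (proj1 (filterlim_locally a (a 0)) (Ha 0) (mkposreal _ He)) as [d Hd].
  assert (Hd0 := cond_pos d).
  specialize (Hd (d / 2)). change (Rabs (d / 2 - 0) < d -> Rabs (a (d / 2) - a 0) < Rabs (a 0)) in Hd.
  rewrite Hz in Hd by lra. rewrite Rminus_0_l, Rabs_Ropp in Hd.
  rewrite Rminus_0_r, Rabs_pos_eq in Hd by lra. apply (Rlt_irrefl (Rabs (a 0))), Hd. lra.
Qed.

Lemma cfun_zero (f : cfun) : (forall t, 0 < t -> f t = RtoC 0) -> f = cf0.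
Proof.
  intros Hz.
  assert (P1 : forall t, 0 < t -> ext_re f t = 0). { intros; rewrite ext_reE, Hz; auto; lra. }
  assert (P2 : forall t, 0 < t -> ext_im f t = 0). { intros; rewrite ext_imE, Hz; auto; lra. }
  assert (Q1 := cts_zero_at0 _ (cre f) P1). assert (Q2 := cts_zero_at0 _ (cim f) P2).
  apply cfun_ext; intros t [Ht | <-]; rewrite cf0E; auto.
  rewrite pairE, Q1, Q2 by lra. reflexivity.
Qed.

Lemma conv_sq_0 f : conv f f = cf0 -> f = cf0.
Proof.
  intros Hff. apply cfun_zero; intros x Hx.
  set (T := 2 * x).
  assert (HT : 0 < T) by (unfold T; lra).
  destruct (ex_RInt_ub (V := C_R_NormedModule) f 0 (2 * T)) as [A HA].
  { apply CInt_ex; lra. }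
  rewrite Rmin_left, Rmax_right in HA by lra.
  assert (HA' : forall t, 0 <= t <= 2 * T -> Cmod (f t) <= A).
  { intros t Ht; rewrite <- normCE; auto. }
  assert (HE : exists wf : R -> R, forall u, wf u = exp (T - u)) by (exists (fun u => exp (T - u)); reflexivity). destruct HE as [w Ew].
  assert (Hw : cts w).
  { apply cts_ext with (fun u => exp (T - u)). now intros. apply (cts_comp exp). apply pt_cts; intros; apply derivable_continuous_pt, derivable_pt_exp.
    apply cts_minus; auto using cts_const, cts_id. }
  assert (K : forall m, Rabs (RInt (fun u => w u ^ m * ext_re f u) 0 T) <= 3 * T * A /\
                        Rabs (RInt (fun u => w u ^ m * ext_im f u) 0 T) <= 3 * T * A).
  { intros m. pose proof (sq_bound f T A m HT Hff HA') as B.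
    rewrite (CInt_pair _ (fun u => exp (- (INR m * u)) * ext_re f u) (fun u => exp (- (INR m * u)) * ext_im f u)) in B;
     try (apply cts_mult; auto; apply cts_exp); [|lra|].
    2: { intros t Ht. rewrite pairE by lra. rewrite mulw_re, mulw_im; auto; lra. }
    pose proof (Rmax_Cmod (RInt (fun u => exp (- (INR m * u)) * ext_re f u) 0 T,
       RInt (fun u => exp (- (INR m * u)) * ext_im f u) 0 T)) as B2. simpl fst in B2; simpl snd in B2.
    assert (He := exp_pos (INR m * T)).
    assert (HI : exp (INR m * T) * exp (- (INR m * T)) = 1).
    { rewrite <- exp_plus, Rplus_opp_r. apply exp_0. }
    assert (G : forall a, cts a -> Rabs (RInt (fun u => exp (- (INR m * u)) * a u) 0 T) <=  3 * T * A * exp (- (INR m * T)) ->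
       Rabs (RInt (fun u => w u ^ m * a u) 0 T) <= 3 * T * A).
    { intros a Ha Hb.
      rewrite (RInt_ext _ (fun u => exp (INR m * T) * (exp (- (INR m * u)) * a u))).
      rewrite RInt_mult_l, Rabs_mult by (apply cts_mult; auto; apply cts_exp).
      rewrite (Rabs_pos_eq (exp _)) by lra.
      apply (Rmult_le_compat_l (exp (INR m * T))) in Hb; [|lra].
      eapply Rle_trans; [apply Hb|]. right.
      transitivity (3 * T * A * (exp (INR m * T) * exp (- (INR m * T)))). ring. rewrite HI; ring.
      intros u _. rewrite Ew, exp_powE. rewrite <- Rmult_assoc, <- exp_plus. f_equal. f_equal. ring. }
    split; (apply G; auto; eapply Rle_trans; [|eapply Rle_trans; [apply B2|apply B]]).
    apply Rmax_l. apply Rmax_r. }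
  assert (w0 : forall x, 0 <= x <= T -> 0 <= w x).
  { intros; rewrite Ew; left; apply exp_pos. }
  assert (wd : forall x y, 0 <= x < y -> y <= T -> w y < w x).
  { intros; rewrite !Ew; apply exp_increasing; lra. }
  assert (wx : 1 < w x).
  { rewrite Ew. rewrite <- exp_0. apply exp_increasing; unfold T; lra. }
  assert (Hx2 : 0 < x < T) by (unfold T; lra).
  rewrite pairE by lra.
  rewrite (moments w (ext_re f) T (3 * T * A) HT Hw (cre f) w0 wd (fun m _ => proj1 (K m)) x Hx2 wx).
  rewrite (moments w (ext_im f) T (3 * T * A) HT Hw (cim f) w0 wd (fun m _ => proj2 (K m)) x Hx2 wx).
  reflexivity.
Qed.

Lemma cts_idpow n : cts (fun t => t ^ n).
Proof. apply (cts_pow (fun t => t)), cts_id. Qed.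

Lemma conv_tmul_0 f g : conv f g = cf0 -> conv f (mulw _ cts_id g) = cf0.
Proof.
  intros H. set (P := conv f (mulw _ cts_id g)). set (Q := conv (mulw _ cts_id f) g).
  assert (QP : cadd Q P = cf0).
  { unfold Q, P. rewrite <- mulw_leibniz, H by (intros; reflexivity). apply cfun_ext; intros t Ht.
    unfold mulw; rewrite mkcfunE, cf0E; auto. apply Cmult_0_r. }
  apply conv_sq_0. fold P.
  assert (PQ : conv P Q = cf0).
  { unfold P, Q. set (tf := mulw _ _ f). set (tg := mulw _ _ g).
    rewrite (conv_comm tf g), conv_assoc, (conv_comm f tg), <- (conv_assoc tg f g), H.
    rewrite conv_0_r. apply conv_0_l. }
  assert (E : conv P (cadd Q P) = conv P P).
  { rewrite conv_add_r, PQ. apply cadd_0_l. }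
  rewrite <- E, QP. apply conv_0_r.
Qed.

Lemma conv_pow_0 f g n : conv f g = cf0 -> conv f (mulw _ (cts_idpow n) g) = cf0.
Proof.
  intros H. induction n as [|n IH].
  - rewrite <- H. f_equal. apply cfun_ext; intros; unfold mulw; rewrite mkcfunE; auto. apply Cmult_1_l.
  - apply conv_tmul_0 in IH. rewrite <- IH. f_equal. apply cfun_ext; intros. unfold mulw; rewrite !mkcfunE; auto.
    simpl. rewrite RtoC_mult. symmetry; apply Cmult_assoc.
Qed.

Theorem titchmarsh f g : conv f g = cf0 -> f = cf0 \/ g = cf0.
Proof.
  intros H.
  assert (M : forall x y, 0 < x -> 0 < y -> Cmult (g y) (f x) = RtoC 0).
  { intros x y Hx Hy. set (t := x + y).
    set (pr := fun u => ext_re g (t - u) * ext_re f u - ext_im g (t - u) * ext_im f u).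
    set (pi := fun u => ext_re g (t - u) * ext_im f u + ext_im g (t - u) * ext_re f u).
    assert (Cr : cts pr). { apply cts_minus; apply cts_rc_in; auto. }
    assert (Ci : cts pi). { apply cts_plus; apply cts_rc_in; auto. }
    set (w := fun u => (t - u) * (2 / y)).
    assert (Hw : cts w). { apply cts_mult; [apply cts_minus|]; auto using cts_const, cts_id. }
    assert (Hy2 : 0 < 2 / y) by (apply Rdiv_lt_0_compat; lra).
    assert (K : forall m, RInt (fun u => w u ^ m * pr u) 0 t = 0 /\ RInt (fun u => w u ^ m * pi u) 0 t = 0).
    { intros m. pose proof (conv_pow_0 f g m H) as E. rewrite conv_comm in E.
      assert (E1 : conv (mulw _ (cts_idpow m) g) f t = RtoC 0) by (rewrite E; apply cf0E).
      assert (Ht : 0 <= t) by (unfold t; lra).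
      assert (C1 : cts (fun u => (t - u) ^ m * pr u)).
      { apply cts_mult; auto. apply (cts_pow (fun u => t - u)), cts_minus; auto using cts_const, cts_id. }
      assert (C2 : cts (fun u => (t - u) ^ m * pi u)).
      { apply cts_mult; auto. apply (cts_pow (fun u => t - u)), cts_minus; auto using cts_const, cts_id. }
      rewrite convE in E1; auto. unfold conv_fun in E1.
      rewrite (CInt_pair _ (fun u => (t - u) ^ m * pr u) (fun u => (t - u) ^ m * pi u)) in E1; auto.
      2: { intros u Hu. rewrite conv_in by lra. rewrite mulw_re, mulw_im by lra.
           unfold pr, pi. f_equal; ring. }
      injection E1; intros E3 E2.
      assert (F : forall a, cts (fun u => (t - u) ^ m * a u) -> RInt (fun u => (t - u) ^ m * a u) 0 t = 0 ->
         RInt (fun u => w u ^ m * a u) 0 t = 0).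
      { intros a Ha Ea. rewrite (RInt_ext _ (fun u => (2 / y) ^ m * ((t - u) ^ m * a u))).
        rewrite RInt_mult_l, Ea by auto. apply Rmult_0_r.
        intros u _. unfold w. rewrite Rpow_mult_distr. apply Rminus_diag_uniq; ring. }
      split; apply F; auto. }
    assert (wd : forall a b, 0 <= a < b -> b <= t -> w b < w a).
    { intros a b Ha Hb. unfold w. apply Rmult_lt_compat_r; lra. }
    assert (w0 : forall a, 0 <= a <= t -> 0 <= w a).
    { intros a Ha. unfold w. apply Rmult_le_pos; lra. }
    assert (wx : 1 < w x).
    { unfold w, t. replace ((x + y - x) * (2 / y)) with 2 by (field; lra). lra. }
    assert (Ht : 0 < t) by (unfold t; lra).
    assert (Hxt : 0 < x < t) by (unfold t; lra).
    assert (Z1 : pr x = 0).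
    { apply (moments w pr t 0 Ht Hw Cr w0 wd); auto. intros m _. rewrite (proj1 (K m)), Rabs_R0; lra. }
    assert (Z2 : pi x = 0).
    { apply (moments w pi t 0 Ht Hw Ci w0 wd); auto. intros m _. rewrite (proj2 (K m)), Rabs_R0; lra. }
    replace y with (t - x) by (unfold t; ring). rewrite conv_in by lra.
    unfold pr in Z1; unfold pi in Z2. rewrite Z1, Z2. reflexivity. }
  destruct (classic (f = cf0)) as [|N]; auto. right.
  apply cfun_zero; intros y Hy.
  destruct (classic (g y = RtoC 0)) as [|Ny]; auto. exfalso. apply N.
  apply cfun_zero; intros x Hx. destruct (classic (f x = RtoC 0)) as [|Nx]; auto.
  exfalso. apply (Cmult_neq_0 _ _ Ny Nx). auto.
Qed.

Lemma scale_cont q (hq : 0 < q) (f : cfun) :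
  continuous_on (fun t => 0 <= t) (fun t => Cmult (RtoC q) (f (q * t))).
Proof.
  assert (S : forall a, cts a -> cts (fun t => q * a (q * t))).
  { intros a Ha. apply cts_mult. apply cts_const. apply (cts_comp a); auto.
    apply cts_mult; auto using cts_const, cts_id. }
  apply cont_on_pair with (fun t => q * ext_re f (q * t)) (fun t => q * ext_im f (q * t)); auto.
  intros t Ht. rewrite pairE by nra. unfold Cmult; simpl; f_equal; ring.
Qed.
(* {q f(qt)} *)
Definition scale q (hq : 0 < q) (f : cfun) : cfun := mkcfun _ (scale_cont q hq f).

Lemma scale_re q hq f t : 0 <= t -> ext_re (scale q hq f) t = q * ext_re f (q * t).
Proof. intros; rewrite !ext_reE by nra. unfold scale. rewrite mkcfunE; auto. apply re_scal_l. Qed.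
Lemma scale_im q hq f t : 0 <= t -> ext_im (scale q hq f) t = q * ext_im f (q * t).
Proof. intros; rewrite !ext_imE by nra. unfold scale. rewrite mkcfunE; auto. apply im_scal_l. Qed.

Lemma scale_add q hq f g : scale q hq (cadd f g) = cadd (scale q hq f) (scale q hq g).
Proof.
  apply cfun_ext; intros t Ht; unfold scale, cadd; rewrite !mkcfunE by nra. 
  apply Cmult_plus_distr_l. Qed.

Lemma scale_conv q hq f g : scale q hq (conv f g) = conv (scale q hq f) (scale q hq g).
Proof.
  assert (P : forall a b a' b', cts a -> cts b ->
     (forall x, 0 <= x -> a' x = q * a (q * x)) -> (forall x, 0 <= x -> b' x = q * b (q * x)) ->
     forall t, 0 <= t -> rc a' b' t = q * rc a b (q * t)).
  { intros a b a' b' Ha Hb Ea Eb t Ht. unfold rc.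
    rewrite <- RInt_mult_l by (apply cts_rc_in; auto).
    set (k := fun v => q * (a (q * t - v) * b v)).
    assert (Hk : cts k) by (apply cts_mult; [apply cts_const | apply cts_rc_in; auto]).
    assert (E := RInt_comp_lin (V := R_CompleteNormedModule) k q 0 0 t (cts_ex _ _ _ Hk)).
    rewrite Rmult_0_r, !Rplus_0_r in E. rewrite <- E.
    apply RInt_ext; intros u. rewrite Rmin_left, Rmax_right; auto; intros Hu.
    rewrite Ea, Eb by lra. unfold k. rewrite Rplus_0_r.
    change (q * a (q * (t - u)) * (q * b (q * u)) = q * (q * (a (q * t - q * u) * b (q * u)))).
    replace (q * (t - u)) with (q * t - q * u) by ring. ring. }
  assert (R := fun f => scale_re q hq f). assert (I := fun f => scale_im q hq f).
  apply cfun_ext2; intros t Ht; [rewrite scale_re, !conv_re|rewrite scale_im, !conv_im]; auto; try nra;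
  unfold rcre, rcim.
  rewrite (P _ _ _ _ (cre f) (cre g) (R f) (R g) t Ht), (P _ _ _ _ (cim f) (cim g) (I f) (I g) t Ht). ring.
  rewrite (P _ _ _ _ (cre f) (cim g) (R f) (I g) t Ht), (P _ _ _ _ (cim f) (cre g) (I f) (R g) t Ht). ring.
Qed.

Lemma scale_eq0 q hq f : scale q hq f = cf0 -> f = cf0.
Proof.
  intros E. apply cfun_ext; intros t Ht.
  assert (E1 : scale q hq f (t / q) = cf0 (t / q)) by now rewrite E.
  assert (0 <= t / q) by (apply Rdiv_le_0_compat; auto).
  rewrite cf0E in E1 |- *. unfold scale in E1; rewrite mkcfunE in E1; auto.
  replace (q * (t / q)) with t in E1 by (field; lra).
  destruct (classic (f t = RtoC 0)) as [|N]; auto. exfalso.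
  apply (Cmult_neq_0 (RtoC q) (f t)); auto. intros Z; apply RtoC_inj in Z; lra.
Qed.

Lemma cts_neg : cts (fun t => - t).
Proof. apply cts_opp, cts_id. Qed.
(* {-t f(t)} *)
Definition tderiv (f : cfun) : cfun := mulw (fun t => - t) cts_neg f.

Lemma tderiv_conv f g : tderiv (conv f g) = cadd (conv (tderiv f) g) (conv f (tderiv g)).
Proof. apply mulw_leibniz; intros; ring. Qed.
Lemma tderiv_add f g : tderiv (cadd f g) = cadd (tderiv f) (tderiv g).
Proof.
  apply cfun_ext; intros t Ht; unfold tderiv, mulw, cadd; rewrite !mkcfunE by auto.
  apply Cmult_plus_distr_l. Qed.

From mathcomp Require Import all_boot all_algebra generic_quotient.
From mathcomp Require Import boolp.
From mathcomp Require Import ring.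
Set Implicit Arguments.
Unset Strict Implicit.
Unset Printing Implicit Defensive.
Import GRing.Theory.
Local Open Scope ring_scope.
Local Open Scope quotient_scope.

HB.instance Definition _ := gen_eqMixin cfun.
HB.instance Definition _ := gen_choiceMixin cfun.
HB.instance Definition _ :=
  GRing.isZmodule.Build cfun cadd_assoc cadd_comm cadd_0_l cadd_opp_l.

Local Notation "f ** g" := (conv f g) (at level 40, left associativity).

Lemma convC : commutative conv. Proof. exact: conv_comm. Qed.
Lemma convA : associative conv. Proof. exact: conv_assoc. Qed.
Lemma convCA : left_commutative conv.
Proof. by move=> x y z; rewrite !convA (convC x). Qed.
Lemma convAC : right_commutative conv.
Proof. by move=> x y z; rewrite -!convA (convC y). Qed.
Lemma convACA : interchange conv conv.
Proof. by move=> x y z t; rewrite -!convA (convCA y). Qed.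
Lemma convDr : right_distributive conv (@GRing.add cfun).
Proof. exact: conv_add_r. Qed.
Lemma convDl : left_distributive conv (@GRing.add cfun).
Proof. by move=> x y z; rewrite !(convC _ z) convDr. Qed.
Lemma conv0r : right_zero (0 : cfun) conv. Proof. exact: conv_0_r. Qed.
Lemma conv0l : left_zero (0 : cfun) conv. Proof. exact: conv_0_l. Qed.
Lemma convNr x y : x ** (- y) = - (x ** y).
Proof. by apply/eqP; rewrite -addr_eq0 -convDr addNr conv0r. Qed.
Lemma convNl x y : (- x) ** y = - (x ** y).
Proof. by rewrite convC convNr convC. Qed.
Lemma conv_eq0 x y : (x ** y == 0) = (x == 0) || (y == 0).
Proof.
apply/eqP/orP => [/titchmarsh [->|->]|[/eqP->|/eqP->]]; rewrite ?eqxx; auto.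
  exact: conv0l. exact: conv0r.
Qed.
Lemma conv_neq0 x y : x != 0 -> y != 0 -> x ** y != 0.
Proof. by rewrite conv_eq0 negb_or => -> ->. Qed.
Lemma convI x y z : x != 0 -> x ** y = x ** z -> y = z.
Proof.
move=> x0 /eqP; rewrite -subr_eq0 -convNr -convDr conv_eq0 (negPf x0) subr_eq0.
by move/eqP.
Qed.
Lemma cl_neq0 : cl != 0.
Proof.
apply/eqP => /(congr1 (fun f : cfun => f R1)).
rewrite cf0E /cl /cconst mkcfunE; last exact: Rle_0_1.
by move=> /RtoC_inj; exact: R1_neq_R0.
Qed.

(* The construction of {fraction R} in fraction.v, for the ring cfun, which has
   no identity and hence is not an idomainType: the constant function cl = {1}
   plays the role of the denominator of integral elements. *)
Record ratio := MkRatio { ratio_val :> cfun * cfun; _ : ratio_val.2 != 0 }.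
HB.instance Definition _ := [isSub for ratio_val].
HB.instance Definition _ := [Choice of ratio by <:].

Lemma den_neq0 (x : ratio) : x.2 != 0. Proof. by case: x. Qed.

Definition nz := (conv_neq0, den_neq0, cl_neq0).

Definition eqv (x y : ratio) := x.1 ** y.2 == x.2 ** y.1.
Lemma eqv_refl : reflexive eqv. Proof. by move=> x; rewrite /eqv convC. Qed.
Lemma eqv_sym : symmetric eqv.
Proof. by move=> x y; rewrite /eqv eq_sym; congr (_ == _); rewrite convC. Qed.
Lemma eqv_trans : transitive eqv.
Proof.
move=> y x z; rewrite /eqv => /eqP xy /eqP yz; apply/eqP.
apply: (convI (den_neq0 y)).
by rewrite convA (convC y.2) xy -convA yz convCA.
Qed.
Canonical eqv_equiv := EquivRel eqv eqv_refl eqv_sym eqv_trans.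

Definition QC := {eq_quot eqv}.
HB.instance Definition _ : EqQuotient _ eqv QC := EqQuotient.on QC.
HB.instance Definition _ := Choice.on QC.

Lemma eqvP (x y : ratio) :
  reflect (x.1 ** y.2 = x.2 ** y.1) (\pi_QC x == \pi_QC y).
Proof. by rewrite eqmodE; exact: eqP. Qed.
Lemma pi_eq (x y : ratio) : x.1 ** y.2 = x.2 ** y.1 -> \pi_QC x = \pi_QC y.
Proof. by move/eqvP/eqP. Qed.
Lemma eqv_repr (x : ratio) :
  x.1 ** (repr (\pi_QC x)).2 = x.2 ** (repr (\pi_QC x)).1.
Proof. by apply/eqvP; rewrite reprK. Qed.

Definition Ratio (a b : cfun) : ratio :=
  insubd (MkRatio (ratio_val := (0, cl)) cl_neq0) (a, b).
Lemma RatioE a b : b != 0 -> Ratio a b = (a, b) :> cfun * cfun.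
Proof. by move=> b0; rewrite /Ratio val_insubd /= b0. Qed.
Lemma Ratio0E a : Ratio a 0 = (0, cl) :> cfun * cfun.
Proof. by rewrite /Ratio val_insubd /= eqxx. Qed.

Definition ratio_add (x y : ratio) := Ratio (x.1 ** y.2 + y.1 ** x.2) (x.2 ** y.2).
Definition ratio_opp (x : ratio) := Ratio (- x.1) x.2.
Definition ratio_mul (x y : ratio) := Ratio (x.1 ** y.1) (x.2 ** y.2).
Definition ratio_inv (x : ratio) := Ratio x.2 x.1.

Definition QCadd := lift_op2 QC ratio_add.
Definition QCopp := lift_op1 QC ratio_opp.
Definition QCmul := lift_op2 QC ratio_mul.
Definition QCinv := lift_op1 QC ratio_inv.
Definition QC0 : QC := \pi_QC (Ratio 0 cl).
Definition QC1 : QC := \pi_QC (Ratio cl cl).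

Section WellDefined.
Variables (x x' y y' : ratio).
Hypotheses (Ex : x.1 ** x'.2 = x.2 ** x'.1) (Ey : y.1 ** y'.2 = y.2 ** y'.1).

Lemma ratio_add_wd : \pi_QC (ratio_add x y) = \pi_QC (ratio_add x' y').
Proof.
apply: pi_eq; rewrite /ratio_add !RatioE ?nz //= convDl (convDr (x.2 ** y.2)).
congr (_ + _); first by rewrite convACA Ex convACA.
by rewrite (convC x'.2) convACA Ey convACA (convC y.2).
Qed.
Lemma ratio_opp_wd : \pi_QC (ratio_opp x) = \pi_QC (ratio_opp x').
Proof.
by apply: pi_eq; rewrite /ratio_opp !RatioE ?nz //= convNl convNr Ex.
Qed.
Lemma ratio_mul_wd : \pi_QC (ratio_mul x y) = \pi_QC (ratio_mul x' y').
Proof.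
by apply: pi_eq; rewrite /ratio_mul !RatioE ?nz //= convACA Ex Ey convACA.
Qed.
Lemma ratio_inv_wd : \pi_QC (ratio_inv x) = \pi_QC (ratio_inv x').
Proof.
apply: pi_eq; rewrite /ratio_inv.
have [x0|x0] := eqVneq x.1 0; last first.
  have x'0 : x'.1 != 0.
    apply: contra_neq (conv_neq0 x0 (den_neq0 x')) => x'0.
    by rewrite Ex x'0 conv0r.
  by rewrite !RatioE //= -Ex.
have x'0 : x'.1 = 0.
  by apply: (convI (den_neq0 x)); rewrite -Ex x0 conv0l conv0r.
by rewrite x0 x'0 !Ratio0E /= conv0l conv0r.
Qed.
End WellDefined.

Lemma pi_add : {morph \pi_QC : x y / ratio_add x y >-> QCadd x y}.
Proof. by move=> x y; unlock QCadd; apply: ratio_add_wd; apply: eqv_repr. Qed.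
Lemma pi_opp : {morph \pi_QC : x / ratio_opp x >-> QCopp x}.
Proof. by move=> x; unlock QCopp; apply: ratio_opp_wd; apply: eqv_repr. Qed.
Lemma pi_mul : {morph \pi_QC : x y / ratio_mul x y >-> QCmul x y}.
Proof. by move=> x y; unlock QCmul; apply: ratio_mul_wd; apply: eqv_repr. Qed.
Lemma pi_inv : {morph \pi_QC : x / ratio_inv x >-> QCinv x}.
Proof. by move=> x; unlock QCinv; apply: ratio_inv_wd; apply: eqv_repr. Qed.

Lemma QCaddA : associative QCadd.
Proof.
elim/quotW=> x; elim/quotW=> y; elim/quotW=> z; rewrite -!pi_add.
rewrite /ratio_add !RatioE ?nz //=; congr (\pi_QC (Ratio _ _)); last exact: convA.
rewrite !convDl !convA addrA; congr (_ + _ + _); first exact: convAC.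
by rewrite -!convA (convC x.2).
Qed.
Lemma QCaddC : commutative QCadd.
Proof.
elim/quotW=> x; elim/quotW=> y; rewrite -!pi_add.
by congr (\pi_QC (Ratio _ _)); [exact: addrC | exact: convC].
Qed.
Lemma QCadd0 : left_id QC0 QCadd.
Proof.
elim/quotW=> x; rewrite -pi_add; apply: pi_eq; rewrite /ratio_add !RatioE ?nz //=.
by rewrite conv0l add0r -convA convC.
Qed.
Lemma QCaddN : left_inverse QC0 QCopp QCadd.
Proof.
elim/quotW=> x; rewrite -pi_opp -pi_add; apply: pi_eq.
rewrite /ratio_add /ratio_opp !RatioE ?nz //=.
by rewrite convNl addNr conv0l conv0r.
Qed.
HB.instance Definition _ :=
  GRing.isZmodule.Build QC QCaddA QCaddC QCadd0 QCaddN.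

Lemma QCmulA : associative QCmul.
Proof.
elim/quotW=> x; elim/quotW=> y; elim/quotW=> z; rewrite -!pi_mul.
by rewrite /ratio_mul !RatioE ?nz //= !convA.
Qed.
Lemma QCmulC : commutative QCmul.
Proof.
elim/quotW=> x; elim/quotW=> y; rewrite -!pi_mul.
by congr (\pi_QC (Ratio _ _)); exact: convC.
Qed.
Lemma QCmul1 : left_id QC1 QCmul.
Proof.
elim/quotW=> x; rewrite -pi_mul; apply: pi_eq; rewrite /ratio_mul !RatioE ?nz //=.
by rewrite convAC.
Qed.
Lemma QCmulDl : left_distributive QCmul QCadd.
Proof.
elim/quotW=> x; elim/quotW=> y; elim/quotW=> z.
rewrite -!pi_mul -!pi_add -!pi_mul; apply: pi_eq.
rewrite /ratio_mul /ratio_add !RatioE ?nz //=.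
rewrite (convACA x.1) (convACA y.1) -convDl (convACA x.2).
by rewrite [LHS]convACA [RHS]convACA (convC (_ + _)) (convCA z.1).
Qed.
Lemma QC1_neq0 : QC1 != 0.
Proof.
apply/eqP => /eqP/eqvP; rewrite !RatioE ?nz //= conv0r => /eqP.
by rewrite conv_eq0 (negPf cl_neq0).
Qed.
HB.instance Definition _ :=
  GRing.Zmodule_isComNzRing.Build QC QCmulA QCmulC QCmul1 QCmulDl QC1_neq0.

Lemma QCmulV (x : QC) : x != 0 -> QCmul (QCinv x) x = 1.
Proof.
elim/quotW: x => x x0.
have {}x0 : x.1 != 0.
  apply: contra_neq x0 => x0; apply: pi_eq.
  by rewrite !RatioE ?nz //= x0 conv0l conv0r.
rewrite -pi_inv -pi_mul; apply: pi_eq; rewrite /ratio_mul /ratio_inv !RatioE ?nz //=.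
by rewrite (convC x.2).
Qed.
Lemma QCinv0 : QCinv 0 = 0.
Proof.
rewrite -pi_inv; apply: pi_eq.
by rewrite /ratio_inv (RatioE _ cl_neq0) /= Ratio0E conv0l conv0r.
Qed.
HB.instance Definition _ := GRing.ComNzRing_isField.Build QC QCmulV QCinv0.

(* a is identified with ab/b; see toQCE for the independence of b. *)
Definition toQC (a : cfun) : QC := \pi_QC (Ratio (a ** cl) cl).

Lemma toQCE a b : b != 0 -> toQC a = \pi_QC (Ratio (a ** b) b).
Proof.
move=> b0; apply: pi_eq; rewrite !RatioE ?nz //=.
by rewrite (convC a cl) convA.
Qed.

Lemma toQCD : {morph toQC : a b / a + b}.
Proof.
move=> a b; rewrite -[RHS]pi_add; apply: pi_eq.
by rewrite /ratio_add !RatioE ?nz //= -!convDl convCA.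
Qed.
Lemma toQCM a b : toQC (a ** b) = toQC a * toQC b.
Proof.
rewrite -[RHS]pi_mul; apply: pi_eq.
by rewrite /ratio_mul !RatioE ?nz //= (convACA a) (convCA cl) -convA.
Qed.
Lemma toQC_inj : injective toQC.
Proof.
move=> a b /eqP/eqvP; rewrite !RatioE ?nz //= => E.
apply: (convI cl_neq0); apply: (convI cl_neq0).
by rewrite (convC cl a) (convC cl b) [LHS]convC.
Qed.
Lemma toQC0 : toQC 0 = 0.
Proof. by apply/(@addrI _ (toQC 0)); rewrite -toQCD !addr0. Qed.
Lemma toQCN a : toQC (- a) = - toQC a.
Proof. by apply/eqP; rewrite -addr_eq0 -toQCD addNr toQC0. Qed.
Lemma toQC_eq0 a : (toQC a == 0) = (a == 0).
Proof. by rewrite -toQC0 (inj_eq toQC_inj). Qed.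

Definition QCnum (x : QC) : cfun := (repr x).1.
Definition QCden (x : QC) : cfun := (repr x).2.
Lemma QCden_neq0 x : QCden x != 0. Proof. exact: den_neq0. Qed.

Lemma pi_Ratio a b : b != 0 -> \pi_QC (Ratio a b) = toQC a / toQC b.
Proof.
move=> b0; apply: (canRL (mulfK _)); first by rewrite toQC_eq0.
rewrite -[LHS]pi_mul; apply: pi_eq; rewrite /ratio_mul !RatioE ?nz //=.
by rewrite [RHS]convCA [RHS]convA.
Qed.
Lemma QC_frac x : x = toQC (QCnum x) / toQC (QCden x).
Proof.
rewrite -pi_Ratio ?QCden_neq0 // -[LHS]reprK; congr (\pi_QC _).
apply: val_inj; rewrite [RHS]RatioE ?QCden_neq0 //; exact: surjective_pairing.
Qed.

(* Defined on the chosen representative of x; tauQC_frac shows that any other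
   representative gives the same value. *)
Definition tauQC (q : R) (hq : Rlt 0 q) (x : QC) : QC :=
  toQC (scale q hq (QCnum x)) / toQC (scale q hq (QCden x)).

Lemma scale_neq0 q hq a : a != 0 -> scale q hq a != 0.
Proof. by apply: contra_neq => /scale_eq0. Qed.

Lemma frac_eq a b c d : b != 0 -> d != 0 ->
  toQC a / toQC b = toQC c / toQC d -> a ** d = c ** b.
Proof.
move=> b0 d0 /eqP; rewrite eqr_div ?toQC_eq0 // -!toQCM => /eqP.
exact: toQC_inj.
Qed.

Lemma tauQC_frac q hq a b : b != 0 ->
  tauQC hq (toQC a / toQC b) = toQC (scale q hq a) / toQC (scale q hq b).
Proof.
move=> b0; rewrite /tauQC; set x := toQC a / toQC b.
have /frac_eq E : toQC (QCnum x) / toQC (QCden x) = toQC a / toQC b.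
  by rewrite -QC_frac.
apply/eqP; rewrite eqr_div ?toQC_eq0 ?scale_neq0 ?QCden_neq0 //.
by rewrite -!toQCM -!scale_conv E ?QCden_neq0.
Qed.

(* The quotient rule on the chosen representative; see ddsQC_frac, and
   ddsQC_toQC, ddsQC_unique for its characterization as an extension. *)
Definition ddsQC (x : QC) : QC :=
  let a := QCnum x in let b := QCden x in
  (toQC (tderiv a) * toQC b - toQC a * toQC (tderiv b)) / toQC b ^+ 2.

Lemma quotient_rule (a a' b b' c c' d d' : QC) : b != 0 -> d != 0 -> a * d = c * b ->
  a' * d + a * d' = c' * b + c * b' ->
  (a' * b - a * b') / b ^+ 2 = (c' * d - c * d') / d ^+ 2.
Proof.
move=> b0 d0 E1 E2; apply/eqP; rewrite eqr_div ?expf_neq0 //; apply/eqP.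
have -> : (a' * b - a * b') * d ^+ 2 =
  (a' * d + a * d') * (b * d) - (a * d) * (d' * b + b' * d) by ring.
by rewrite E2 E1; ring.
Qed.

Lemma ddsQC_frac a b : b != 0 -> ddsQC (toQC a / toQC b) =
  (toQC (tderiv a) * toQC b - toQC a * toQC (tderiv b)) / toQC b ^+ 2.
Proof.
move=> b0; rewrite /ddsQC; set x := toQC a / toQC b.
have /frac_eq E : toQC (QCnum x) / toQC (QCden x) = toQC a / toQC b.
  by rewrite -QC_frac.
have {}E := E (QCden_neq0 x) b0.
apply: quotient_rule; rewrite ?toQC_eq0 ?QCden_neq0 //.
  by rewrite -!toQCM E.
by rewrite -!toQCM -!toQCD -[_ + _]tderiv_conv E tderiv_conv.
Qed.
Lemma ddsQC_toQC a : ddsQC (toQC a) = toQC (tderiv a).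
Proof.
have c0 : toQC cl != 0 by rewrite toQC_eq0 cl_neq0.
rewrite -[toQC a](mulfK c0) -toQCM ddsQC_frac ?cl_neq0 // [tderiv _]tderiv_conv.
rewrite toQCD !toQCM; field. by [].
Qed.
Lemma tauQC_toQC q hq a : tauQC hq (toQC a) = toQC (scale q hq a).
Proof.
have c0 : toQC cl != 0 by rewrite toQC_eq0 cl_neq0.
rewrite -[toQC a](mulfK c0) -toQCM tauQC_frac ?cl_neq0 //.
by rewrite scale_conv toQCM mulfK // toQC_eq0 scale_neq0 ?cl_neq0.
Qed.

Definition is_derivation (K : fieldType) (D : K -> K) : Prop :=
  (forall x y, D (x + y) = D x + D y) /\
  (forall x y, D (x * y) = D x * y + x * D y).

Lemma ddsQC_unique (D : QC -> QC) : is_derivation D ->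
  (forall a, D (toQC a) = toQC (tderiv a)) -> D =1 ddsQC.
Proof.
move=> [_ DM] Da x.
have b0 : toQC (QCden x) != 0 by rewrite toQC_eq0 QCden_neq0.
have Ea : toQC (QCnum x) = x * toQC (QCden x) by rewrite {2}[x]QC_frac divfK.
have := DM x (toQC (QCden x)); rewrite -Ea !Da /ddsQC Ea => ->.
by field.
Qed.

(* (K, tau) is a difference field: tau is an injective endomorphism of K. *)
Definition is_difference_field (K : fieldType) (tau : K -> K) : Prop :=
  [/\ zmod_morphism tau, monoid_morphism tau & injective tau].

Definition is_DT_field (K : fieldType) (D tau : K -> K) : Prop :=
  is_derivation D /\ is_difference_field tau.

(* alpha is identified with {alpha} / {1}. *)
Definition constQC (alpha : C) : QC := toQC (cconst alpha) / toQC cl.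

Definition lQC : QC := toQC cl.
Definition sQC : QC := 1 / lQC.

Definition DQC (x : QC) : QC := - sQC ^+ 2 * ddsQC x.

(* Main.v *)
Require Import Defs.
From Stdlib Require Import Reals Lra.
From Coquelicot Require Import Coquelicot.

(* Every element of Q(C) is a fraction toQC a / toQC b, on which tau_q is given by
   the scaling f(t) |-> q f(qt) and d/ds by f(t) |-> -t f(t) and the quotient rule,
   so each identity reduces to one on C. The two that matter: scaling multiplies
   constant functions by q, which cancels in {alpha}/{1} and gives tau_q l = q l;
   and scaling after multiplying by -t is q times multiplying by -t after scaling,
   whence tau_q (d/ds) = q (d/ds) tau_q. *)

Section ContinuousFunctions.
Local Open Scope R_scope.

Definition smul (k : R) (f : cfun) : cfun := mulw (fun _ => k) (cts_const k) f.

(** Both sides integrate [k * f] over [0, t]. With denominators cleared, this makes pointwise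
    multiplication by [k] the multiplication by {k}/{1} in Q(C). *)
Lemma conv_const_smul k f : conv (cconst (RtoC k)) f = conv cl (smul k f).
Proof.
  apply cfun_ext2; intros t Ht; [rewrite !conv_re|rewrite !conv_im]; auto;
  unfold rcre, rcim, rc, smul, cl; f_equal; apply RInt_ext; intros u;
  rewrite Rmin_left, Rmax_right; auto; intros Hu;
  rewrite ?mulw_re, ?mulw_im, ?cconst_re, ?cconst_im by lra; simpl; ring.
Qed.

Lemma scale_const q hq a : scale q hq (cconst a) = smul q (cconst a).
Proof.
  apply cfun_ext; intros t Ht; unfold scale, smul, mulw, cconst.
  rewrite !mkcfunE; auto; nra.
Qed.

(** The weight -t is evaluated at qt on the left, which supplies the extra factor [q]. *)
Lemma scale_tderiv q hq f : scale q hq (tderiv f) = smul q (tderiv (scale q hq f)).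
Proof.
  apply cfun_ext2; intros t Ht; unfold smul, tderiv.
  - rewrite scale_re, !mulw_re, scale_re; auto; nra.
  - rewrite scale_im, !mulw_im, scale_im; auto; nra.
Qed.

Lemma scaleK p q hp hq f : p * q = 1 -> scale p hp (scale q hq f) = f.
Proof.
  intros pq; apply cfun_ext2; intros t Ht;
  [rewrite !scale_re|rewrite !scale_im]; auto; try nra;
  rewrite <- !Rmult_assoc, (Rmult_comm q p), pq, !Rmult_1_l; auto.
Qed.

(** Both sides are {-t}. Read in Q(C) this is dl/ds = -l^2, whence D l = s^2 l^2 = 1. *)
Lemma tderiv_cl : tderiv cl = copp (conv cl cl).
Proof.
  apply cfun_ext; intros t Ht; unfold copp; rewrite mkcfunE by auto.
  rewrite cl_conv by auto.
  rewrite (CInt_pair _ (fun _ => 1) (fun _ => 0)); auto using cts_const.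
  - rewrite !(RInt_const (V := R_CompleteNormedModule)).
    unfold tderiv, mulw, cl, cconst; rewrite !mkcfunE by auto.
    unfold Cmult, Copp, scal, RtoC; simpl; unfold mult; simpl.
    f_equal; ring.
  - intros u Hu; unfold cl, cconst; rewrite mkcfunE by lra; reflexivity.
Qed.

End ContinuousFunctions.

From HB Require Import structures.
From mathcomp Require Import all_boot all_algebra.
From mathcomp Require Import ring.
Import GRing.Theory.
Local Open Scope ring_scope.

Lemma toQCl_neq0 : toQC cl != 0.
Proof. by rewrite toQC_eq0 cl_neq0. Qed.

Lemma toQC_smul k f : toQC (smul k f) = constQC (RtoC k) * toQC f.
Proof.
rewrite /constQC mulrAC; apply: (canRL (mulfK toQCl_neq0)).
by rewrite -!toQCM conv_const_smul convC.
Qed.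

Lemma constQC_neq0 k : k <> R0 -> constQC (RtoC k) != 0.
Proof.
move=> k0; rewrite /constQC mulf_neq0 ?invr_eq0 ?toQCl_neq0 // toQC_eq0.
apply/eqP => /(congr1 (fun f : cfun => f R0)).
rewrite cf0E /cconst mkcfunE; last exact: Rle_refl.
by move=> /RtoC_inj.
Qed.

(** Replaces the chosen representatives by arbitrary fractions, to which [tauQC_frac] and
    [ddsQC_frac] apply. *)
Lemma QC_ind (P : QC -> Prop) :
  (forall a b, b != 0 -> P (toQC a / toQC b)) -> forall x, P x.
Proof. by move=> H x; rewrite [x]QC_frac; apply/H/QCden_neq0. Qed.

Lemma QC1E : (1 : QC) = toQC cl / toQC cl.
Proof. by rewrite divff ?toQCl_neq0. Qed.

Section ScaleOperator.
Variables (q : R) (hq : Rlt R0 q).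
Local Notation tau := (tauQC hq).

Lemma tauQCM x y : tau (x * y) = tau x * tau y.
Proof.
elim/QC_ind: x => a b b0; elim/QC_ind: y => c d d0.
by rewrite mulf_div -!toQCM !tauQC_frac ?conv_neq0 // !scale_conv !toQCM mulf_div.
Qed.

Lemma tauQCD x y : tau (x + y) = tau x + tau y.
Proof.
elim/QC_ind: x => a b b0; elim/QC_ind: y => c d d0.
rewrite addf_div ?toQC_eq0 // -!toQCM -toQCD !tauQC_frac ?conv_neq0 //.
rewrite [scale _ _ (_ + _)]scale_add !scale_conv toQCD !toQCM.
by rewrite addf_div // toQC_eq0 scale_neq0.
Qed.

Lemma tauQCB x y : tau (x - y) = tau x - tau y.
Proof. by apply/(@addIr _ (tau y)); rewrite -tauQCD !subrK. Qed.

Lemma tauQC1 : tau 1 = 1.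
Proof.
rewrite QC1E tauQC_frac ?cl_neq0 //.
by rewrite !divff ?toQC_eq0 ?scale_neq0 ?cl_neq0.
Qed.

HB.instance Definition _ := GRing.isZmodMorphism.Build QC QC tau tauQCB.
HB.instance Definition _ := GRing.isMonoidMorphism.Build QC QC tau (tauQC1, tauQCM).

Lemma tauQC_constQC alpha : tau (constQC alpha) = constQC alpha.
Proof.
rewrite /constQC tauQC_frac ?cl_neq0 // !scale_const !toQC_smul.
by rewrite -mulf_div divff ?mul1r // constQC_neq0 //; apply/Rgt_not_eq.
Qed.

Lemma tauQC_l : tau lQC = constQC (RtoC q) * lQC.
Proof. by rewrite tauQC_toQC scale_const toQC_smul. Qed.

Lemma tauQC_s : tau sQC = sQC / constQC (RtoC q).
Proof. by rewrite /sQC !div1r fmorphV /= tauQC_l invfM mulrC. Qed.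

(** Each term in the numerator of the quotient rule contains exactly one [tderiv], so [scale_tderiv]
    gives each one factor [q]. *)
Lemma tauQC_ddsQC x : tau (ddsQC x) = constQC (RtoC q) * ddsQC (tau x).
Proof.
elim/QC_ind: x => a b b0.
rewrite tauQC_frac // !ddsQC_frac ?scale_neq0 //.
rewrite rmorphM fmorphV rmorphXn rmorphB !rmorphM /= !tauQC_toQC.
by rewrite !scale_tderiv !toQC_smul; ring.
Qed.

(** [tau] sends s^2 to s^2/q^2, and passing d/ds across it costs one factor [q]; together
    [tau D = (1/q) D tau]. *)
Lemma DQC_tauQC x : DQC (tau x) = constQC (RtoC q) * tau (DQC x).
Proof.
have q0 : constQC (RtoC q) != 0 by apply/constQC_neq0/Rgt_not_eq.
rewrite /DQC rmorphM rmorphN rmorphXn /= tauQC_s tauQC_ddsQC.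
by field.
Qed.

End ScaleOperator.

(** Supplies the inverse of [tauQC hq], namely the operator for 1/q. *)
Lemma tauQCK p q hp hq : Rmult p q = R1 -> cancel (@tauQC p hp) (@tauQC q hq).
Proof.
move=> pq; elim/QC_ind => a b b0.
by rewrite !tauQC_frac ?scale_neq0 // !scaleK // Rmult_comm.
Qed.

(** Primed letters are free variables standing for derivatives. The left side is the quotient rule
    for (ad + cb)/(bd) with the Leibniz rule already expanded. *)
Lemma quotient_ruleD (F : fieldType) (a a' b b' c c' d d' : F) :
  b != 0 -> d != 0 ->
  ((a' * d + a * d' + (c' * b + c * b')) * (b * d)
    - (a * d + c * b) * (b' * d + b * d')) / (b * d) ^+ 2 =
  (a' * b - a * b') / b ^+ 2 + (c' * d - c * d') / d ^+ 2.
Proof. by move=> b0 d0; field; rewrite b0 d0. Qed.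

(** The same for the product (ac)/(bd). *)
Lemma quotient_ruleM (F : fieldType) (a a' b b' c c' d d' : F) :
  b != 0 -> d != 0 ->
  ((a' * c + a * c') * (b * d) - (a * c) * (b' * d + b * d')) / (b * d) ^+ 2 =
  (a' * b - a * b') / b ^+ 2 * (c / d) + a / b * ((c' * d - c * d') / d ^+ 2).
Proof. by move=> b0 d0; field; rewrite b0 d0. Qed.

Lemma ddsQC_derivation : is_derivation ddsQC.
Proof.
split; elim/QC_ind => a b b0; elim/QC_ind => c d d0.
  rewrite addf_div ?toQC_eq0 // -!toQCM -toQCD !ddsQC_frac ?conv_neq0 //.
  rewrite [tderiv (_ + _)]tderiv_add !tderiv_conv !toQCD !toQCM.
  by apply: quotient_ruleD; rewrite toQC_eq0.
rewrite mulf_div -!toQCM !ddsQC_frac ?conv_neq0 // !tderiv_conv !toQCD !toQCM.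
by apply: quotient_ruleM; rewrite toQC_eq0.
Qed.

(** A fixed multiple of a derivation of a field is again a derivation. *)
Lemma DQC_derivation : is_derivation DQC.
Proof.
have [dD dM] := ddsQC_derivation.
by split=> x y; rewrite /DQC ?dD ?dM; ring.
Qed.

Lemma DQC_l : DQC lQC = 1.
Proof.
rewrite /DQC /sQC /lQC ddsQC_toQC tderiv_cl [toQC (copp _)]toQCN toQCM.
by field; rewrite toQCl_neq0.
Qed.

Theorem theorem3p4 (q : R) (hq : Rlt 0 q) :
  (is_difference_field (tauQC hq) /\ bijective (tauQC hq)) /\
  [/\ (forall alpha : C, tauQC hq (constQC alpha) = constQC alpha),
      tauQC hq lQC = constQC (RtoC q) * lQC,
      tauQC hq sQC = sQC / constQC (RtoC q) &
      [/\ DQC lQC = 1,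
          is_DT_field DQC (tauQC hq),
          (forall x : QC, DQC (tauQC hq x) = constQC (RtoC q) * tauQC hq (DQC x)) &
          (forall x : QC, lQC * DQC (tauQC hq x) = tauQC hq (lQC * DQC x))]].
Proof.
have bij : bijective (tauQC hq).
  have hq' := Rinv_0_lt_compat _ hq.
  by exists (tauQC hq'); apply: tauQCK; [apply: Rinv_r | apply: Rinv_l];
    apply: Rgt_not_eq.
have diff : is_difference_field (tauQC hq).
  split; [exact: tauQCB | by split; [exact: tauQC1 | exact: tauQCM] | exact: bij_inj].
split=> //; split; [exact: tauQC_constQC | exact: tauQC_l | exact: tauQC_s | split].
- exact: DQC_l.
- split=> //; exact: DQC_derivation.
- exact: DQC_tauQC.
(* The factor [q] from the commutation rule is the one in tau l = q l. *)
- by move=> x; rewrite DQC_tauQC tauQCM tauQC_l; ring.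
Qed.
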